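(* If $(K,v)$ is henselian, then $\deg f=\deg_Qf\cdot\deg Q$ for every $f\in\mathrm{KP}_\infty(\mathcal Q)$ and every $Q\in\mathcal Q$.
   Context: Let $(K,v)$ be a valued field, $\Gamma$ the divisible hull of $vK$, embedded in a divisible ordered abelian group $\Lambda$. Let $\nu\colon K[x]\to\Lambda\cup\{\infty\}$ be a valuation extending $v$ which is well-specified, i.e. it is not the case that simultaneously $\nu^{-1}(\infty)=0$, the value group of $\nu$ modulo $\Gamma$ is torsion, and the residue field of $\nu$ is algebraic over that of $v$. For $s\ge0$ let $\partial_s$ be the $s$-th Hasse–Schmidt derivative, defined by $f(x+y)=\sum_{s\ge0}(\partial_sf)y^s$. For nonconstant $f$ with $\nu(f)<\infty$ the level is $\epsilon_\nu(f)=\max\{(\nu(f)-\nu(\partial_sf))/s: s\ge1\}$; $\epsilon_\nu(a)=-\infty$ for $a\in K$. A monic $Q\in K[x]$ is a key polynomial for $\nu$ if $\epsilon_\nu(f)<\epsilon_\nu(Q)$ whenever $\deg f<\deg Q$. For monic $Q$, each $f$ has a unique $Q$-expansion $f=\sum_{i\ge0}f_{Q,i}Q^i$ with $\deg f_{Q,i}<\deg Q$; set $\nu_Q(f)=\min_i\nu(f_{Q,i}Q^i)$, $S_Q(f)=\{i:\nu(f_{Q,i}Q^i)=\nu_Q(f)\}$, $\deg_Qf=\max S_Q(f)$. Fix $m\ge1$ such that the set $\Psi_m$ of key polynomials of degree $m$ for $\nu$ is nonempty and has no element of maximal $\nu$-value. Let $\mathcal Q\subseteq\Psi_m$ be well-ordered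 by $Q<R\iff\nu(Q)<\nu(R)$ and cofinal in $\Psi_m$ for $\nu$-values. A polynomial $f$ is $\mathcal Q$-stable if $\nu_Q(f)=\nu(f)$ for all $Q$ in some final segment of $\mathcal Q$, $\mathcal Q$-unstable otherwise. Assume unstable polynomials exist; limit key polynomials are the monic $\mathcal Q$-unstable polynomials of minimal degree, forming the set $\mathrm{KP}_\infty(\mathcal Q)$. *)

(* Defs.v *)
From HB Require Import structures.
From mathcomp Require Import all_boot all_order all_algebra.
Set Implicit Arguments. Unset Strict Implicit. Unset Printing Implicit Defensive.
Import Order.TTheory GRing.Theory Num.Theory.
Local Open Scope ring_scope.

(* A divisible ordered abelian group Lambda.  A divisible torsion-free     *)
(* abelian group carries a unique Q-vector space structure, so we model    *)
(* Lambda as a Q-vector space with a total order compatible with +.        *)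
Record divOrdGroup := DivOrdGroup {
  dog_sort :> lmodType rat;
  dog_le : rel dog_sort;
  dog_refl : reflexive dog_le;
  dog_anti : antisymmetric dog_le;
  dog_trans : transitive dog_le;
  dog_total : total dog_le;
  dog_addr : forall x y z : dog_sort, dog_le x y -> dog_le (x + z) (y + z)
}.

Section Ext.
Variable L : divOrdGroup.

Definition leL (x y : L) : bool := dog_le x y.
Definition ltL (x y : L) : bool := (x != y) && dog_le x y.

(* Lambda \cup {oo}, with None = oo *)
Definition leE (x y : option L) : bool :=
  match x, y with
  | _, None => true
  | None, Some _ => false
  | Some a, Some b => leL a b
  end.
Definition ltE (x y : option L) : bool := (x != y) && leE x y.
Definition addE (x y : option L) : option L :=
  match x, y with Some a, Some b => Some (a + b) | _, _ => None end.
Definition minE (x y : option L) : option L := if leE x y then x else y.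

Inductive lvl := LMinus | LFin of L | LPlus.
Definition lvl_le (x y : lvl) : bool :=
  match x, y with
  | LMinus, _ => true
  | _, LPlus => true
  | LFin a, LFin b => leL a b
  | _, _ => false
  end.
Definition lvl_lt (x y : lvl) : bool := lvl_le x y && ~~ lvl_le y x.
Definition lvl_max (x y : lvl) : lvl := if lvl_le x y then y else x.
End Ext.

Section Val.
Variables (K : fieldType) (L : divOrdGroup).
Implicit Types (v : K -> option L) (nu : {poly K} -> option L).

Definition is_valuation v : Prop :=
  [/\ forall x, v x = None <-> x = 0,
      forall x y, v (x * y) = addE (v x) (v y) &
      forall x y, leE (minE (v x) (v y)) (v (x + y))].

(* (K,v) henselian: Hensel's lemma for simple residual roots *)
Definition henselian v : Prop :=
  forall (p : {poly K}) (a : K), p \is monic ->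
    (forall i, leE (Some 0) (v p`_i)) -> leE (Some 0) (v a) ->
    ltE (Some 0) (v p.[a]) -> v (deriv p).[a] = Some 0 ->
    exists b, p.[b] = 0 /\ ltE (Some 0) (v (b - a)).

(* nu is a valuation on K[x] (possibly with nontrivial support) extending v *)
Definition is_poly_valuation v nu : Prop :=
  [/\ nu 0 = None, nu 1 = Some 0,
      forall f g, nu (f * g) = addE (nu f) (nu g),
      forall f g, leE (minE (nu f) (nu g)) (nu (f + g)) &
      forall a, nu a%:P = v a].

(* Gamma = divisible hull of vK inside Lambda *)
Definition in_Gamma v (g : L) : Prop :=
  exists (n : nat) (a : K), (0 < n)%N /\ v a = Some (g *+ n).

Definition in_value_group nu (l : L) : Prop :=
  exists f g a b, nu f = Some a /\ nu g = Some b /\ l = a - b.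

(* residue field of nu (on the fraction field) algebraic over that of v:
   every residue class of f/g with nu(f) >= nu(g) satisfies a polynomial
   over the residue field of v with nonzero reduction. *)
Definition residue_algebraic v nu : Prop :=
  forall f g b, nu g = Some b -> leE (Some b) (nu f) ->
    exists (n : nat) (c : nat -> K),
      [/\ forall i, (i <= n)%N -> leE (Some 0) (v (c i)),
          exists2 i, (i <= n)%N & v (c i) = Some 0 &
          ltE (Some (b *+ n))
              (nu (\sum_(i < n.+1) c i *: (f ^+ i * g ^+ (n - i))))].

Definition well_specified v nu : Prop :=
  ~ [/\ forall f, nu f = None -> f = 0,
        forall l, in_value_group nu l -> exists2 n, (0 < n)%N & in_Gamma v (l *+ n) &
        residue_algebraic v nu].

Definition hasse (s : nat) (f : {poly K}) : {poly K} := nderivn s f.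

(* the level epsilon_nu(f); convention: +oo if f nonconstant with nu f = oo *)
Definition level nu (f : {poly K}) : lvl L :=
  if (size f <= 1)%N then LMinus L else
  match nu f with
  | None => LPlus L
  | Some a =>
      foldr (@lvl_max L) (LMinus L)
        [seq match nu (hasse s f) with
             | None => LMinus L
             | Some b => LFin ((s%:R : rat)^-1 *: (a - b))
             end | s <- iota 1 (size f).-1]
  end.

Definition key_poly nu (Q : {poly K}) : Prop :=
  Q \is monic /\
  forall f : {poly K}, (size f < size Q)%N -> lvl_lt (level nu f) (level nu Q).

(* Q-expansion coefficients f_{Q,i}: f = sum_i f_{Q,i} Q^i, deg f_{Q,i} < deg Q *)
Definition qcoef (Q f : {poly K}) (i : nat) : {poly K} := (f %/ Q ^+ i) %% Q.

Definition nuQ nu (Q f : {poly K}) : option L :=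
  foldr (@minE L) None [seq nu (qcoef Q f i * Q ^+ i) | i <- iota 0 (size f)].

Definition degQ nu (Q f : {poly K}) : nat :=
  \max_(i < size f | nu (qcoef Q f i * Q ^+ i) == nuQ nu Q f) i.

Definition Psi nu (m : nat) (Q : {poly K}) : Prop :=
  key_poly nu Q /\ (size Q).-1 = m.

Definition Qstable nu (QQ : {poly K} -> Prop) (f : {poly K}) : Prop :=
  exists2 Q0, QQ Q0 &
    forall Q, QQ Q -> leE (nu Q0) (nu Q) -> nuQ nu Q f = nu f.

Definition limit_key_poly nu (QQ : {poly K} -> Prop) (f : {poly K}) : Prop :=
  [/\ f \is monic, ~ Qstable nu QQ f &
      forall g, g \is monic -> ~ Qstable nu QQ g -> (size f <= size g)%N].

Definition good_family nu (m : nat) (QQ : {poly K} -> Prop) : Prop :=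
  [/\ forall Q, QQ Q -> Psi nu m Q,
      forall Q R, QQ Q -> QQ R -> nu Q = nu R -> Q = R,
      forall S : {poly K} -> Prop, (forall Q, S Q -> QQ Q) -> (exists Q, S Q) ->
        exists2 Q0, S Q0 & forall R, S R -> leE (nu Q0) (nu R) &
      forall P, Psi nu m P -> exists2 Q, QQ Q & leE (nu P) (nu Q)].
End Val.

(* Main.v *)
Require Import Defs.
From HB Require Import structures.
From mathcomp Require Import all_boot all_order all_fingroup all_algebra all_field.
From mathcomp Require Import mpoly ring.
From mathcomp Require boolp classical_sets.
Import GRing.Theory.
Local Open Scope ring_scope.
Set Implicit Arguments. Unset Strict Implicit. Unset Printing Implicit Defensive.

(* Let [e] be the level of a key polynomial [Q].  On [K[x]], the truncation [nu_Q]
   is [p |-> min_s (nu (hasse s p) + s e)], i.e. the Gauss valuation of weight [e]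
   of the Taylor expansion [p (x + y)], and the largest [s] realizing the minimum
   is [d * deg_Q p], where [d > 0] is that [s] for [p = Q].  In particular [nu_Q]
   is multiplicative and grows with the level, so a limit key polynomial [f] is
   irreducible and no multiple of [f] is stable.

   Extend [v] to a valuation [w] of a splitting field of [f Q].  Henselianity makes
   [w (g (x))] the same for all roots [x] of [f], and comparing the single-slope
   polynomial of [g (x)] with [nu] shows that this common value is [nu g] when
   [deg g < deg f].  Hence, around any root [x] of [f], the closed ball of radius
   [e] contains exactly [d] roots of [Q] and [d * deg_Q f] roots of [f].  Counting
   the pairs of a root of [f] and a root of [Q] in a common ball gives
   [deg f * d <= deg Q * (d * deg_Q f)]; the other inequality is clear. *)

(** * Ordered groups and Gauss valuations *)

(** [Q]-expansions do not pass to the roots of [f], but Taylor expansions do: evaluating their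
    coefficients at a root [x] gives the expansion at [x]. For [s > 0] the coefficient [hasse s f]
    has degree below [deg f], so its value at [x] is known. The constant term of [f] becomes 0 at
    [x]; this does no harm, because instability already keeps [nu f] strictly above the truncated
    value. The definition of [henselian] lifts only simple residual roots, whereas all conjugates
    [g(x)] may be residually equal. Products of conjugates repair this: if [r] conjugates have least
    value, exactly one product of [r] conjugates has least value. Divided by the sum of all such
    products it has residue 1, the others residue 0, and irreducibility of [f] then forces
    [r = deg f]. The common value of the [g(x)] must be [nu g]: let [h] be the monic polynomial with
    roots [g(x)]. Otherwise a single term of [h(g)] would strictly dominate and [h(g)], a multiple
    of [f], would be stable. *)

Section OrderedGroup.
Variable L : divOrdGroup.
Implicit Types (a b c d : L) (x y z : option L).

Lemma leLL a : leL a a. Proof. exact: dog_refl. Qed.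

Lemma leL_trans b a c : leL a b -> leL b c -> leL a c.
Proof. exact: dog_trans. Qed.

Lemma leL_anti a b : leL a b -> leL b a -> a = b.
Proof. by move=> ab ba; apply: dog_anti; rewrite [dog_le a b]ab. Qed.

Lemma leL_total a b : leL a b || leL b a.
Proof. exact: dog_total. Qed.

Lemma leL_add2r c a b : leL (a + c) (b + c) = leL a b.
Proof.
apply/idP/idP; last exact: dog_addr.
by move/(dog_addr (- c)); rewrite !addrK.
Qed.

Lemma leL_add2l c a b : leL (c + a) (c + b) = leL a b.
Proof. by rewrite ![c + _]addrC leL_add2r. Qed.

Lemma leLD a b c d : leL a b -> leL c d -> leL (a + c) (b + d).
Proof.
by move=> ab cd; apply: (@leL_trans (b + c)); rewrite ?leL_add2r ?leL_add2l.
Qed.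

Lemma leL_muln n a b : leL a b -> leL (a *+ n) (b *+ n).
Proof.
move=> ab; elim: n => [|n IH]; first by rewrite !mulr0n leLL.
by rewrite !mulrS leLD.
Qed.

Lemma mulrnL_inj n a b : (0 < n)%N -> a *+ n = b *+ n -> a = b.
Proof.
move=> n0; rewrite -!scaler_nat => /(congr1 (fun z : L => (n%:R : rat)^-1 *: z)).
by rewrite !scalerA mulVf ?scale1r // Num.Theory.pnatr_eq0 -lt0n.
Qed.

Lemma leL_pmuln n a b : (0 < n)%N -> leL (a *+ n) (b *+ n) = leL a b.
Proof.
move=> n0; apply/idP/idP; last exact: leL_muln.
move=> nab; case/orP: (leL_total a b) => // ba.
by rewrite (mulrnL_inj n0 (leL_anti nab (leL_muln n ba))) leLL.
Qed.

Lemma leExx x : leE x x. Proof. by case: x => //= a; apply: leLL. Qed.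

Lemma leE_trans y x z : leE x y -> leE y z -> leE x z.
Proof. by case: x y z => [a|] [b|] [c|] //=; apply: leL_trans. Qed.

Lemma leE_anti x y : leE x y -> leE y x -> x = y.
Proof. by case: x y => [a|] [b|] //= ab ba; rewrite (leL_anti ab ba). Qed.

Lemma leE_total x y : leE x y || leE y x.
Proof. by case: x y => [a|] [b|] //=; apply: leL_total. Qed.

Lemma ltEN x y : ltE x y = ~~ leE y x.
Proof.
rewrite /ltE; case: eqVneq => [->|xy] /=; first by rewrite leExx.
have := leE_total x y; case xyE: (leE x y) => /=; last by move->.
by move=> _; apply/esym/negP => /(leE_anti xyE) /eqP; rewrite (negbTE xy).
Qed.

Lemma ltEW x y : ltE x y -> leE x y.
Proof. by case/andP. Qed.

Lemma ltE_irr x : ltE x x = false.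
Proof. by rewrite ltEN leExx. Qed.

Lemma leEP x y : leE x y = false -> ltE y x.
Proof. by rewrite ltEN => ->. Qed.

Lemma ltE_le_trans y x z : ltE x y -> leE y z -> ltE x z.
Proof. by rewrite !ltEN => xy yz; apply: contra xy => /(leE_trans yz). Qed.

Lemma leE_lt_trans y x z : leE x y -> ltE y z -> ltE x z.
Proof. by rewrite !ltEN => xy; apply: contra => /leE_trans; apply. Qed.

Lemma leE_None x : leE x None. Proof. by case: x. Qed.

Lemma leE_minP x y z : leE z (minE x y) = leE z x && leE z y.
Proof.
rewrite /minE; case: ifP => xy.
  by apply/idP/andP => [zx|[]//]; split=> //; apply: leE_trans xy.
have yx := ltEW (leEP xy).
by apply/idP/andP => [zy|[]//]; split=> //; apply: leE_trans yx.
Qed.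

Lemma addEC : commutative (@addE L).
Proof. by case=> [a|] [b|] //=; rewrite addrC. Qed.

Lemma addEA : associative (@addE L).
Proof. by case=> [a|] [b|] [c|] //=; rewrite addrA. Qed.

Lemma add0E : left_id (Some 0) (@addE L).
Proof. by case=> [a|] //=; rewrite add0r. Qed.

HB.instance Definition _ := Monoid.isComLaw.Build (option L) (Some 0) (@addE L)
  addEA addEC add0E.

Lemma addE0 : right_id (Some 0) (@addE L).
Proof. by move=> x; rewrite addEC add0E. Qed.

Lemma leE_add2r a x y : leE (addE x (Some a)) (addE y (Some a)) = leE x y.
Proof. by case: x y => [b|] [c|] //=; rewrite leL_add2r. Qed.

Lemma ltE_add2r a x y : ltE (addE x (Some a)) (addE y (Some a)) = ltE x y.
Proof. by rewrite !ltEN leE_add2r. Qed.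

Lemma leE_subr a b y : leE (Some b) (addE y (Some a)) = leE (Some (b - a)) y.
Proof. by case: y => //= c; rewrite -(leL_add2r a (b - a)) subrK. Qed.

Lemma ltE_subr a b y : ltE (Some b) (addE y (Some a)) = ltE (Some (b - a)) y.
Proof. by case: y => //= c; rewrite !ltEN /= -(leL_add2r a c (b - a)) subrK. Qed.

Lemma leED x y z t : leE x y -> leE z t -> leE (addE x z) (addE y t).
Proof. by case: x y z t => [?|] [?|] [?|] [?|] //=; apply: leLD. Qed.

Lemma ltE_leD a b y t : ltE (Some a) y -> leE (Some b) t ->
  ltE (Some (a + b)) (addE y t).
Proof.
move=> ay bt; apply: (@ltE_le_trans (addE y (Some b))).
  by rewrite -[Some (a + b)]/(addE (Some a) (Some b)) ltE_add2r.
by rewrite leED ?leExx.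
Qed.

Lemma leE_ltD a b y t : leE (Some a) y -> ltE (Some b) t ->
  ltE (Some (a + b)) (addE y t).
Proof. by move=> ay bt; rewrite addrC addEC ltE_leD. Qed.

Lemma ltL_pmuln n a b : (0 < n)%N ->
  ltE (Some (a *+ n)) (Some (b *+ n)) = ltE (Some a) (Some b).
Proof. by move=> n0; rewrite !ltEN /= leL_pmuln. Qed.

End OrderedGroup.

Section RingValuation.
Variables (L : divOrdGroup) (A : comNzRingType).

Definition ring_valuation (nu : A -> option L) : Prop :=
  [/\ nu 0 = None, nu 1 = Some 0,
      forall f g, nu (f * g) = addE (nu f) (nu g) &
      forall f g, leE (minE (nu f) (nu g)) (nu (f + g))].

Variable nu : A -> option L.
Hypothesis nuP : ring_valuation nu.

Let nu0 : nu 0 = None. Proof. by case: nuP. Qed.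
Let nu1 : nu 1 = Some 0. Proof. by case: nuP. Qed.
Let nuM f g : nu (f * g) = addE (nu f) (nu g). Proof. by case: nuP. Qed.

Lemma val_leD x f g : leE x (nu f) -> leE x (nu g) -> leE x (nu (f + g)).
Proof.
case: nuP => _ _ _ /(_ f g) le_min xf xg; apply: leE_trans le_min.
by rewrite leE_minP xf.
Qed.

Lemma val_ltD x f g : ltE x (nu f) -> ltE x (nu g) -> ltE x (nu (f + g)).
Proof.
case: nuP => _ _ _ /(_ f g) + xf xg; rewrite /minE.
by case: ifP => _; apply: ltE_le_trans.
Qed.

Lemma valN f : nu (- f) = nu f.
Proof.
suff nuN1 : nu (- 1) = Some 0 by rewrite -mulN1r nuM nuN1 add0E.
have := nuM (- 1) (- 1); rewrite mulrNN mulr1 nu1.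
case: (nu (- 1)) => //= a [] /esym aa; congr Some.
by apply: (@mulrnL_inj _ 2) => //; rewrite mulr2n aa mul0rn.
Qed.

Lemma val_sum_le x (I : Type) (r : seq I) (P : pred I) (F : I -> A) :
  (forall i, P i -> leE x (nu (F i))) -> leE x (nu (\sum_(i <- r | P i) F i)).
Proof.
by apply: (big_ind (fun f => leE x (nu f))); [rewrite nu0 leE_None | exact: val_leD].
Qed.

Lemma val_sum_lt c (I : Type) (r : seq I) (P : pred I) (F : I -> A) :
  (forall i, P i -> ltE (Some c) (nu (F i))) ->
  ltE (Some c) (nu (\sum_(i <- r | P i) F i)).
Proof.
by apply: (big_ind (fun f => ltE (Some c) (nu f))); [rewrite nu0 | exact: val_ltD].
Qed.

Lemma val_addl f g c : nu f = Some c -> ltE (Some c) (nu g) -> nu (f + g) = Some c.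
Proof.
move=> fc cg; apply: leE_anti; last by rewrite val_leD ?fc ?leExx ?ltEW.
rewrite -[leE _ _]negbK -ltEN; apply/negP => cfg.
have : ltE (Some c) (nu (f + g + - g)) by rewrite val_ltD ?valN.
by rewrite addrK fc ltE_irr.
Qed.

Lemma val_prod (I : Type) (r : seq I) (P : pred I) (F : I -> A) :
  nu (\prod_(i <- r | P i) F i) = \big[@addE L/Some 0]_(i <- r | P i) nu (F i).
Proof. exact: (big_morph nu nuM nu1). Qed.

Lemma valX f n c : nu f = Some c -> nu (f ^+ n) = Some (c *+ n).
Proof.
by move=> fc; elim: n => [|n IH]; rewrite ?nu1 // exprS nuM IH fc mulrS.
Qed.

Section Gauss.
Variable e : L.

Definition gterm (p : {poly A}) (s : nat) : option L := addE (nu p`_s) (Some (e *+ s)).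

(* The Gauss valuation with weight [e] on the variable takes the value [c] at
   [p], and [d] is the largest exponent of a term of that value. *)
Definition gauss_dom (p : {poly A}) (c : L) (d : nat) : Prop :=
  [/\ gterm p d = Some c, forall s, leE (Some c) (gterm p s) &
      forall s, (d < s)%N -> ltE (Some c) (gterm p s)].

(** Two computations of one Gauss valuation are matched through this lemma: the root counts and the
    multiples [d * deg_Q] both arise as the dominant exponent. *)
Lemma gauss_dom_uniq p c d c' d' :
  gauss_dom p c d -> gauss_dom p c' d' -> c = c' /\ d = d'.
Proof.
move=> [pd lep ltp] [pd' lep' ltp'].
have cc' : c = c'.
  suff [//] : Some c = Some c'.
  by apply: leE_anti; [rewrite -pd' lep | rewrite -pd lep'].
split=> //; case: (ltngtP d d') => // [/ltp|/ltp'].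
  by rewrite pd' cc' ltE_irr.
by rewrite pd cc' ltE_irr.
Qed.

(** The two conditions on [q] are uneven on purpose: below [d] a tie with [c] is harmless, since
    only the largest exponent of value [c] is recorded, while at [d] strictness prevents
    cancellation. *)
Lemma gauss_dom_add p q c d : gauss_dom p c d ->
  (forall s, leE (Some c) (gterm q s)) ->
  (forall s, (d <= s)%N -> ltE (Some c) (gterm q s)) ->
  gauss_dom (p + q) c d.
Proof.
move=> [pd lep ltp] leq ltq.
split=> [|s|s ds]; last 2 first.
- by move: (lep s) (leq s); rewrite /gterm coefD !leE_subr; apply: val_leD.
- move: (ltp s ds) (ltq s (ltnW ds)); rewrite /gterm coefD !ltE_subr.
  exact: val_ltD.
move: (ltq d (leqnn d)) pd; rewrite /gterm coefD.
case pdE: (nu p`_d) => [b|] //= + [cE]; rewrite -cE.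
by rewrite ltE_subr addrK => /(val_addl pdE) ->.
Qed.

Lemma gauss_domM p q c d c' d' :
  gauss_dom p c d -> gauss_dom q c' d' -> gauss_dom (p * q) (c + c') (d + d').
Proof.
move=> [pd lep ltp] [qd leq ltq].
have termM i j s : (i + j = s)%N ->
  addE (nu (p`_i * q`_j)) (Some (e *+ s)) = addE (gterm p i) (gterm q j).
  move=> <-; rewrite nuM mulrnDr /gterm.
  by rewrite -[Some (_ + _)]/(addE (Some _) (Some _)) -!addEA; congr addE; rewrite addEA [addE (nu q`_j) _]addEC -addEA.
have gterm_sum s : gterm (p * q) s =
    addE (nu (\sum_(i < s.+1) p`_i * q`_(s - i))) (Some (e *+ s)).
  by rewrite /gterm coefM.
have lt_term i j : (d < i)%N || (d' < j)%N ->
    ltE (Some (c + c')) (addE (gterm p i) (gterm q j)).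
  by case/orP => [di|dj]; [apply: ltE_leD; [exact: ltp | exact: leq]
                          |apply: leE_ltD; [exact: lep | exact: ltq]].
have le_term i j : leE (Some (c + c')) (addE (gterm p i) (gterm q j)).
  by rewrite -[Some (_ + _)]/(addE (Some _) (Some _)) leED.
split=> [|s|s dds]; rewrite gterm_sum.
(* In degree [d + d'] every other pair of exponents has [i > d] or [j > d'], so nothing can cancel
   the product of the two dominant coefficients. *)
- have dlt : (d < (d + d').+1)%N by rewrite ltnS leq_addr.
  rewrite (bigD1 (Ordinal dlt)) //= addKn.
  have nud : nu (p`_d * q`_d') = Some (c + c' - e *+ (d + d')).
    have := termM d d' _ (erefl _); rewrite pd qd /=.
    by case: (nu (p`_d * q`_d')) => //= x [<-]; rewrite addrK.
  rewrite (val_addl nud) /= ?subrK //; apply: val_sum_lt => i i_neq.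
  rewrite -ltE_subr (termM i (d + d' - i)%N) ?subnKC ?lt_term ?leq_ord //.
  case: (ltngtP d i) => //= [id|di]; first by rewrite ltn_subRL ltn_add2r.
  by case/eqP: i_neq; apply: val_inj.
- rewrite leE_subr; apply: val_sum_le => i _.
  by rewrite -leE_subr (termM i (s - i)%N) ?subnKC ?leq_ord.
- rewrite ltE_subr; apply: val_sum_lt => i _.
  rewrite -ltE_subr (termM i (s - i)%N) ?subnKC ?lt_term ?leq_ord //.
  case: (leqP i d) => //= id; rewrite ltn_subRL.
  by apply: leq_ltn_trans dds; rewrite leq_add2r.
Qed.

End Gauss.
End RingValuation.

(** * Extension of valuations *)

Section FieldValuation.
Variables (K : fieldType) (L : divOrdGroup) (v : K -> option L).
Hypothesis vP : is_valuation v.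

Lemma valuation_eq0 a : (v a == None) = (a == 0).
Proof. by case: vP => /(_ a) va0 _ _; apply/eqP/eqP => /va0. Qed.

Lemma valuation1 : v 1 = Some 0.
Proof.
case: vP => _ /(_ 1 1) + _; rewrite mulr1.
case v1: (v 1) => [a|] => [[/esym]|_].
  by move/(canRL (addrK a)); rewrite subrr => ->.
by have := oner_eq0 K; rewrite -valuation_eq0 v1.
Qed.

Lemma valuation_ring : ring_valuation v.
Proof. by case: vP => v0 vM vD; split; rewrite ?valuation1 //; apply/v0. Qed.

Lemma valuationV a c : v a = Some c -> v a^-1 = Some (- c).
Proof.
move=> va; have a0 : a != 0 by rewrite -valuation_eq0 va.
have : v (a * a^-1) = Some 0 by rewrite mulfV // valuation1.
case: vP => _ -> _; rewrite va; case: (v a^-1) => //= b [/(canRL (addKr c))->].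
by rewrite addr0.
Qed.

End FieldValuation.

Section Chevalley.
Variables (K W : fieldType) (L : divOrdGroup) (v : K -> option L).
Variable i : {rmorphism K -> W}.
Hypothesis vP : is_valuation v.

(** The equivalence, instead of an inclusion, makes [A] meet [K] exactly in the valuation ring of
    [v], and it yields [1] in [A]. Maximality among these rings plays the part of the domination
    order in Chevalley's theorem. *)
Definition subring_over (A : W -> Prop) : Prop :=
  [/\ forall c, A (i c) <-> leE (Some 0) (v c),
      forall x y, A x -> A y -> A (x - y) &
      forall x y, A x -> A y -> A (x * y)].

Section Maximal.
Variable A : W -> Prop.
Hypothesis A_over : subring_over A.
Hypothesis A_max : forall B, subring_over B -> (forall x, A x -> B x) ->
  forall x, B x -> A x.

Let A_K c : A (i c) <-> leE (Some 0) (v c). Proof. by case: A_over. Qed.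
Let A_sub x y : A x -> A y -> A (x - y). Proof. by case: A_over => ? + ?; apply. Qed.
Let A_mul x y : A x -> A y -> A (x * y). Proof. by case: A_over => ? ?; apply. Qed.
Let A_1 : A 1.
Proof. by rewrite -(rmorph1 i); apply/A_K; rewrite valuation1 // leExx. Qed.
Let A_0 : A 0.
Proof. by rewrite -(subrr 1); apply: A_sub. Qed.
Let A_add x y : A x -> A y -> A (x + y).
Proof. by move=> Ax Ay; rewrite -[y]opprK -[- y]sub0r; do 2?apply: A_sub. Qed.
Let A_exp x n : A x -> A (x ^+ n).
Proof. by move=> Ax; elim: n => [|n IH]; rewrite ?exprS //; apply: A_mul. Qed.

(* As [v] is a valuation, these products already form the ideal of [A] that
   the maximal ideal of [v] generates. *)
Let J x := exists c a, [/\ ltE (Some 0) (v c), A a & x = i c * a].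

Let J_A x : J x -> A x.
Proof. by case=> c [a [c0 Aa ->]]; apply: A_mul => //; apply/A_K/ltEW. Qed.

Let J_mul x y : A x -> J y -> J (x * y).
Proof.
move=> Ax [c [a [c0 Aa ->]]]; exists c, (x * a); split=> //; first exact: A_mul.
by rewrite mulrCA.
Qed.

Let J_0 : J 0.
Proof.
exists 0, 0; split=> //; last by rewrite mulr0.
by have [-> _ _ _] := valuation_ring vP.
Qed.

Let J_add x y : J x -> J y -> J (x + y).
Proof.
move=> [c [a [c0 Aa ->]]] [d [b [d0 Ab ->]]].
wlog cd : c d a b c0 d0 Aa Ab / leE (v c) (v d) => [IH|].
  by case/orP: (leE_total (v c) (v d)) => /IH; [apply | rewrite addrC; apply].
have [d00|d_neq0] := eqVneq d 0; first by exists c, a; rewrite d00 rmorph0 mul0r addr0.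
exists c, (a + i (d / c) * b); split=> //.
  apply: A_add => //; apply: A_mul => //; apply/A_K.
  move: d_neq0; rewrite -(valuation_eq0 vP); case: vP => _ -> _.
  case vc: (v c) cd => [g|]; case vd: (v d) => [h|] //= gh _.
  by rewrite (valuationV vP vc) /= -(leL_add2r g) add0r subrK.
have c_neq0 : c != 0.
  by apply: contraTneq cd => ->; move: d_neq0; rewrite -(valuation_eq0 vP);
    have [-> _ _ _] := valuation_ring vP; case: (v d).
by rewrite mulrDr mulrA -rmorphM mulrCA mulfV // mulr1.
Qed.

Let J_1 : ~ J 1.
Proof.
case=> c [a [c0 Aa ca]].
have c_neq0 : c != 0 by apply: contraTneq (oner_neq0 W) => c00; rewrite ca c00 rmorph0 mul0r eqxx.
have : A (i c^-1).
  suff -> : i c^-1 = a by [].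
  by apply: (mulfI (_ : i c != 0)); rewrite ?fmorph_eq0 // -rmorphM mulfV // rmorph1.
move/A_K; move: c_neq0 c0; rewrite -(valuation_eq0 vP).
case vc: (v c) => [x|] // _; rewrite (valuationV vP vc) ltEN /= => /negP c0.
by rewrite -(leL_add2r x) add0r addNr.
Qed.

Let coefsJ (p : {poly W}) := forall n, J p`_n.

Let coefsJ_add p q : coefsJ p -> coefsJ q -> coefsJ (p + q).
Proof. by move=> Jp Jq n; rewrite coefD; apply: J_add. Qed.

(** If [x] is not in [A], then [A[x]] is strictly larger, so by maximality it contains some [i c]
    with [v c < 0]. Dividing an expression of [i c] by [i c] itself writes 1 with coefficients in
    [J]. *)
Let adjoin_J x : ~ A x -> exists2 p, coefsJ p & p.[x] = 1.
Proof.
move=> nAx; apply: boolp.contrapT => noJ; apply: nAx.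
pose B y := exists2 p : {poly W}, (forall n, A p`_n) & p.[x] = y.
have subAB y : A y -> B y.
  by move=> Ay; exists y%:P; rewrite ?hornerC // => n; rewrite coefC; case: ifP.
apply: (A_max (B := B)) => //; last first.
  by exists 'X; rewrite ?hornerX // => n; rewrite coefX; case: (_ == _).
split=> [c|_ _ [p Ap <-] [q Aq <-]|_ _ [p Ap <-] [q Aq <-]]; last 2 first.
- by exists (p - q); rewrite ?hornerE // => n; rewrite coefB; apply: A_sub.
- exists (p * q); rewrite ?hornerM // => n; rewrite coefM.
  by elim/big_rec: _ => // k y _ Ay; apply: A_add => //; apply: A_mul.
split=> [[p Ap px]|/A_K /subAB //].
case cE: (leE (Some 0) (v c)) => //; case: noJ.
have vc0 := leEP cE; case vc: (v c) vc0 => [y|] // y0.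
exists (i c^-1 *: p) => [n|]; last first.
  by rewrite hornerZ px -rmorphM mulVf ?rmorph1 // -(valuation_eq0 vP) vc.
rewrite coefZ; exists c^-1, p`_n; split=> //; rewrite (valuationV vP vc).
by move: y0; rewrite !ltEN /= -(leL_add2r (- y) 0) subrr add0r.
Qed.

(** Chevalley's descent on the total length: the shorter relation is used to shorten the longer one,
    which is [p] after a possible exchange of [x] and [x^-1]. *)
Let no_double_J N (x : W) (p q : {poly W}) : x != 0 -> (size p + size q <= N)%N ->
  coefsJ p -> coefsJ q -> p.[x] = 1 -> q.[x^-1] = 1 -> False.
Proof.
elim: N x p q => [|N IH] x p q x0 szpq Jp Jq px qx.
  move: szpq; rewrite leqn0 addn_eq0 size_poly_eq0 => /andP[/eqP p0 _].
  by move: px; rewrite p0 horner0 => /eqP; rewrite eq_sym oner_eq0.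
wlog qp : x p q x0 szpq Jp Jq px qx / (size q <= size p)%N => [wl|].
  case/orP: (leq_total (size q) (size p)) => [|pq]; first exact: (wl x p q).
  by apply: (wl x^-1 q p); rewrite ?invr_eq0 ?invrK // addnC.
case szp: (size p) => [|n].
  by move: px; move/eqP: szp; rewrite size_poly_eq0 => /eqP->; rewrite horner0 => /eqP; rewrite eq_sym oner_eq0.
case szq: (size q) => [|k].
  by move: qx; move/eqP: szq; rewrite size_poly_eq0 => /eqP->; rewrite horner0 => /eqP; rewrite eq_sym oner_eq0.
have pE : \sum_(j < n) p`_j * x ^+ j + p`_n * x ^+ n = 1.
  by rewrite -px horner_coef szp big_ord_recr.
have qE : q`_0 + \sum_(j < k) q`_j.+1 * x^-1 ^+ j.+1 = 1.
  rewrite -qx horner_coef szq big_ord_recl expr0 mulr1; congr (_ + _).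
(* Write [1 = q_0 + (1 - q_0) p(x)]. The top term of [p] disappears by
   [(1 - q_0) x^n = sum_j q_(j+1) x^(n-j-1)], where the exponents are nonnegative because [k <= n].
   Thus [1 - q_0] need not be inverted. *)
pose p1 := (q`_0)%:P + (1 - q`_0) *: \poly_(j < n) p`_j
           + \sum_(j < k) (p`_n * q`_j.+1) *: 'X^(n - j.+1).
have kn : (k <= n)%N by rewrite -ltnS -szp -szq.
have [n0|n_gt0] := posnP n.
  by apply: J_1; rewrite -pE n0 big_ord0 add0r expr0 mulr1; apply: Jp.
apply: (IH x p1 q) => //.
- rewrite -ltnS; apply: leq_trans szpq; rewrite ltn_add2r szp ltnS.
  apply: leq_trans (size_polyD _ _) _; rewrite geq_max; apply/andP; split.
    apply: leq_trans (size_polyD _ _) _; rewrite geq_max; apply/andP; split.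
      by rewrite size_polyC; case: (_ == 0).
    by apply: leq_trans (size_scale_leq _ _) _; apply: size_poly.
  apply: leq_trans (size_sum _ _ _) _; apply/bigmax_leqP => j _.
  apply: leq_trans (size_scale_leq _ _) _; rewrite size_polyXn.
  by rewrite -subSn ?subSS ?leq_subr // (leq_trans (ltn_ord j)).
- apply: coefsJ_add; first apply: coefsJ_add.
  + by move=> j; rewrite coefC; case: ifP.
  + move=> j; rewrite coefZ coef_poly; case: ifP => _; rewrite ?mulr0 //.
    by apply: J_mul; [apply: A_sub; [|exact: J_A (Jq 0%N)] | exact: Jp].
  + elim/big_rec: _ => [j|j r _ Jr]; first by rewrite coef0.
    apply: coefsJ_add => // l; rewrite coefZ coefXn.
    case: (_ == _); rewrite ?mulr0 ?mulr1 //.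
    by apply: J_mul; [exact: J_A (Jp n) | exact: Jq].
rewrite !hornerE horner_sum horner_poly.
have -> : \sum_(j < k) ((p`_n * q`_j.+1) *: 'X^(n - j.+1)).[x] =
    p`_n * x ^+ n * \sum_(j < k) q`_j.+1 * x^-1 ^+ j.+1.
  rewrite mulr_sumr; apply: eq_bigr => j _; rewrite !hornerE exprVn.
  rewrite expfB_cond; last by rewrite (negPf x0) /= (leq_trans (ltn_ord j)).
  by rewrite /=; ring.
rewrite -[\sum_(j < k) _](addKr q`_0) qE.
by rewrite -[\sum_(j < n) _](addrK (p`_n * x ^+ n)) pE; ring.
Qed.

Lemma maximal_subring_valuation x : A x \/ A x^-1.
Proof.
have [->|x0] := eqVneq x 0; first by left.
apply: boolp.contrapT => /boolp.not_orP[/adjoin_J[p Jp px] /adjoin_J[q Jq qx]].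
exact: (@no_double_J (size p + size q) x p q).
Qed.

Let A_total x y : x != 0 -> y != 0 -> A (x / y) \/ A (y / x).
Proof. by move=> x0 y0; have := maximal_subring_valuation (x / y); rewrite invf_div. Qed.

Let unitA x := [/\ x != 0, A x & A x^-1].

Let unitA_M x y : unitA x -> unitA y -> unitA (x * y).
Proof. by move=> [x0 Ax Ax'] [y0 Ay Ay']; split; rewrite ?mulf_neq0 ?invfM //; apply: A_mul. Qed.

Let unitA_V x : unitA x -> unitA x^-1.
Proof. by move=> [x0 Ax Ax']; split; rewrite ?invr_eq0 ?invrK. Qed.

Let unitA_X x n : unitA x -> unitA (x ^+ n).
Proof. by move=> [x0 Ax Ax']; split; rewrite ?expf_neq0 -?exprVn //; apply: A_exp. Qed.

Let unitA_K c : unitA (i c) -> v c = Some 0.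
Proof.
move=> [ic0 /A_K c0]; rewrite -fmorphV => /A_K c'0.
move: c0 c'0; case vc: (v c) => [x|] /=; last first.
  by move: ic0; rewrite fmorph_eq0 -(valuation_eq0 vP) vc.
rewrite (valuationV vP vc) /= -(leL_add2r x 0 (- x)) add0r addNr => x0 x0'.
by rewrite (leL_anti x0 x0').
Qed.

Let nonunit x := A x /\ ~ A x^-1 \/ x = 0.

(** This is locality of [A]: if [x / y] is in [A] and [x + y] is invertible there, then so is [y],
    by [y^-1 = (1 + x / y) / (x + y)]. *)
Let nonunit_add x y : nonunit x -> nonunit y -> nonunit (x + y).
Proof.
have [->|x0] := eqVneq x 0; first by rewrite add0r.
have [->|y0] := eqVneq y 0; first by rewrite addr0.
case=> [[Ax Ax']|/eqP]; last by rewrite (negPf x0).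
case=> [[Ay Ay']|/eqP]; last by rewrite (negPf y0).
have [->|xy0] := eqVneq (x + y) 0; first by right.
left; split; first exact: A_add.
move=> Axy; case: (A_total x0 y0) => [xy|yx].
  apply: Ay'; have -> : y^-1 = (1 + x / y) * (x + y)^-1.
    by rewrite -{1}(mulfV y0) -mulrDl addrC mulrAC mulfV ?mul1r.
  by apply: A_mul => //; apply: A_add.
apply: Ax'; have -> : x^-1 = (1 + y / x) * (x + y)^-1.
  by rewrite -{1}(mulfV x0) -mulrDl mulrAC mulfV ?mul1r.
by apply: A_mul => //; apply: A_add.
Qed.

(** Any two nonzero elements are comparable for divisibility in [A], so a finite family has a member
    of least value. *)
Let dominating (s : seq W) : s != [::] -> (forall t, t \in s -> t != 0) ->
  exists2 t, t \in s & forall u, u \in s -> A (u / t).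
Proof.
elim: s => // a s IH _ nz; have a0 : a != 0 by apply: nz; rewrite mem_head.
have [->|s0] := eqVneq s [::].
  by exists a; rewrite ?mem_head // => u; rewrite inE => /eqP->; rewrite mulfV.
have [t ts tmax] := IH s0 (fun u us => nz u (mem_behead (us : u \in behead (a :: s)))).
have t0 : t != 0 by apply: nz; rewrite inE ts orbT.
case: (A_total a0 t0) => at'.
  exists t; first by rewrite inE ts orbT.
  by move=> u; rewrite inE => /orP[/eqP->|/tmax].
exists a; rewrite ?mem_head // => u; rewrite inE => /orP[/eqP->|/tmax ut].
  by rewrite mulfV.
have -> : u / a = u / t * (t / a) by rewrite mulrA mulfVK.
exact: A_mul.
Qed.

(* Two terms of an algebraic equation for [x] must have the same value. *)
Let algebraic_power x : algebraicOver i x -> x != 0 ->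
  exists k c, [/\ (0 < k)%N, c != 0 & unitA (x ^+ k / i c)].
Proof.
move=> [p p0 /rootP px] x0.
have ip j : p`_j != 0 -> i p`_j * x ^+ j != 0.
  by move=> pj; rewrite mulf_neq0 ?fmorph_eq0 ?expf_neq0.
pose r := [seq j <- iota 0 (size p) | p`_j != 0].
pose s := [seq i p`_j * x ^+ j | j <- r].
have s0 : s != [::].
  rewrite -size_eq0 size_map size_filter -lt0n -has_count; apply/hasP.
  exists (size p).-1; last by rewrite -[_`__]/(lead_coef p) lead_coef_eq0.
  by rewrite mem_iota /= prednK // size_poly_gt0.
have snz t : t \in s -> t != 0.
  by case/mapP => j; rewrite mem_filter => /andP[/ip ? _] ->.
have [_ /mapP[j jr ->] tmax] := dominating s0 snz.
move: (jr); rewrite mem_filter => /andP[pj jp].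
have tj := ip _ pj.
have [[l lr lj]|nol] := boolp.pselect (exists2 l, l \in r &
    l != j /\ unitA (i p`_l * x ^+ l / (i p`_j * x ^+ j))); last first.
  (* Without a second term of least value, the other terms divided by the dominant one are nonunits,
     hence so is their sum; but the equation makes this sum equal to -1. *)
  exfalso; have : nonunit (\sum_(l <- r | l != j) i p`_l * x ^+ l / (i p`_j * x ^+ j)).
    rewrite big_seq_cond; elim/big_rec: _ => [|l y /andP[lr lj] ny]; first by right.
    apply: nonunit_add => //; left; split; first by apply/tmax/map_f.
    move=> A'; case: nol; exists l => //; split=> //; split=> //; last exact/tmax/map_f.
    by rewrite mulf_neq0 ?invr_eq0 // ip //; move: lr; rewrite mem_filter => /andP[].
  rewrite -mulr_suml.
  have -> : \sum_(l <- r | l != j) i p`_l * x ^+ l = - (i p`_j * x ^+ j).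
    apply/eqP; rewrite -subr_eq0 opprK addrC; apply/eqP.
    rewrite -[RHS]px horner_coef size_map_poly.
    rewrite -(big_mkord predT (fun l => (map_poly i p)`_l * x ^+ l)) /index_iota subn0.
    rewrite [RHS](bigID (fun l => p`_l != 0)) /= [X in _ = _ + X]big1 ?addr0; last first.
      by move=> l; rewrite negbK coef_map => /eqP->; rewrite /= rmorph0 mul0r.
    rewrite -[X in _ = X]big_filter -/r [RHS](bigD1_seq j) ?filter_uniq ?iota_uniq //=.
    by rewrite coef_map; congr (_ + _); apply: eq_bigr => l _; rewrite coef_map.
  rewrite mulNr mulfV //; case=> [[_]|/eqP]; last by rewrite oppr_eq0 oner_eq0.
  by apply; rewrite invrN invr1 -sub0r; apply: A_sub.
have [lj' U] := lj.
have pl : p`_l != 0 by move: lr; rewrite mem_filter => /andP[].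
case: (ltngtP l j) => [ltlj|ltjl|/eqP]; last by rewrite (negPf lj').
- exists (j - l)%N, (p`_l / p`_j); rewrite subn_gt0 mulf_neq0 ?invr_eq0 //.
  split=> //; have := unitA_V U; congr unitA.
  by rewrite fmorph_div expfB //; field; rewrite ?fmorph_eq0 ?pl ?pj ?expf_neq0 ?x0.
- exists (l - j)%N, (p`_j / p`_l); rewrite subn_gt0 mulf_neq0 ?invr_eq0 //.
  split=> //; move: U; congr unitA.
  by rewrite fmorph_div expfB //; field; rewrite ?fmorph_eq0 ?pl ?pj ?expf_neq0 ?x0.
Qed.

Hypothesis algW : forall x : W, algebraicOver i x.

(** Some power [x ^+ k] equals [i c] up to a unit of [A], which forces [k] times the value of [x] to
    be [v c]. Divisibility of [L] leaves room for the quotient, so the value group need not be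
    enlarged. *)
Let value x y := (x = 0 /\ y = None) \/
  exists k c a, [/\ (0 < k)%N, v c = Some a, unitA (x ^+ k / i c) &
                    y = Some ((k%:R : rat)^-1 *: a)].

Let value_ex x : exists y, value x y.
Proof.
have [->|x0] := eqVneq x 0; first by exists None; left.
have [k [c [k0 c0 U]]] := algebraic_power (algW x) x0.
case vc: (v c) => [a|]; last by move/eqP: vc; rewrite (valuation_eq0 vP) (negPf c0).
by exists (Some ((k%:R : rat)^-1 *: a)); right; exists k, c, a.
Qed.

Let natV_muln (a : L) k : (0 < k)%N -> ((k%:R : rat)^-1 *: a) *+ k = a.
Proof.
move=> k0; rewrite -scaler_nat scalerA mulfV ?scale1r //.
by rewrite Num.Theory.pnatr_eq0 -lt0n.
Qed.

Let value_neq0 x b : value x (Some b) -> x != 0.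
Proof.
case=> [[_]//|[k [c [a [k0 _ [+ _ _] _]]]]].
by apply: contraNneq => ->; rewrite expr0n gtn_eqF // mul0r.
Qed.

(** Passing to the common power [x ^+ (k * l)] makes [c ^+ l / d ^+ k] a unit of [A] coming from
    [K], and such a unit has value 0. *)
Let value_uniq x b b' : value x (Some b) -> value x (Some b') -> b = b'.
Proof.
case=> [[_]//|[k [c [a [k0 vc U [->]]]]]].
case=> [[_]//|[l [d [a' [l0 vd U' [->]]]]]].
have kl0 : (0 < k * l)%N by rewrite muln_gt0 k0.
apply: (mulrnL_inj kl0); rewrite mulrnA natV_muln // mulnC mulrnA natV_muln //.
have c0 : c != 0 by rewrite -(valuation_eq0 vP) vc.
have d0 : d != 0 by rewrite -(valuation_eq0 vP) vd.
have x0 : x != 0.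
  case: U => U0 _ _; apply: contraNneq U0 => ->.
  by rewrite expr0n gtn_eqF // mul0r.
have : unitA (i (c ^+ l / d ^+ k)).
  have := unitA_M (unitA_V (unitA_X l U)) (unitA_X k U'); congr unitA.
  rewrite !expr_div_n -!exprM [(l * k)%N]mulnC fmorph_div !rmorphXn.
  by field; rewrite ?x0 ?expf_neq0 ?fmorph_eq0 ?c0 ?d0.
move/unitA_K; have [_ _ vM _] := valuation_ring vP.
rewrite vM (valX (valuation_ring vP) l vc).
have vdk := valX (valuation_ring vP) k vd.
by rewrite (valuationV vP vdk) => -[/eqP]; rewrite subr_eq0 => /eqP.
Qed.

Let value_M x y b b' : value x (Some b) -> value y (Some b') ->
  value (x * y) (Some (b + b')).
Proof.
case=> [[_]//|[k [c [a [k0 vc U [->]]]]]].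
case=> [[_]//|[l [d [a' [l0 vd U' [->]]]]]].
have kl0 : (0 < k * l)%N by rewrite muln_gt0 k0.
right; exists (k * l)%N, (c ^+ l * d ^+ k), (a *+ l + a' *+ k); split=> //.
- have [_ _ vM _] := valuation_ring vP.
  by rewrite vM !(valX (valuation_ring vP) _ vc, valX (valuation_ring vP) _ vd).
- have := unitA_M (unitA_X l U) (unitA_X k U'); congr unitA.
  rewrite !expr_div_n -!exprM [(l * k)%N]mulnC mulrACA -exprMn -invfM.
  by rewrite rmorphM !rmorphXn.
congr Some; apply: (mulrnL_inj kl0); rewrite natV_muln // mulrnDl.
by rewrite mulrnA natV_muln // mulnC mulrnA natV_muln.
Qed.

(** The converse is integral closedness of [A]: if [x ^+ k] and [x^-1] are in [A], so is
    [x = x ^+ k * x^-1 ^+ k.-1]. *)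
Let value_ge0 x b : value x (Some b) -> (A x <-> leL 0 b).
Proof.
case=> [[_]//|[k [c [a [k0 vc [U0 AU AU'] [->]]]]]].
have c0 : i c != 0 by rewrite fmorph_eq0 -(valuation_eq0 vP) vc.
rewrite -(leL_pmuln 0 _ k0) natV_muln // mul0rn.
rewrite -[leL 0 a]/(leE (Some 0) (Some a)) -vc; split=> [Ax|/A_K Ac].
  apply/A_K; rewrite -[i c]invrK; have -> : (i c)^-1^-1 = (x ^+ k / i c)^-1 * x ^+ k.
    rewrite invf_div invrK mulrVK // unitfE.
    by apply: contraNneq U0 => ->; rewrite mul0r.
  by apply: A_mul => //; apply: A_exp.
have Axk : A (x ^+ k) by rewrite -[x ^+ k](mulfVK c0); apply: A_mul.
case: (maximal_subring_valuation x) => // Ax'.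
have [->//|x0] := eqVneq x 0.
suff -> : x = x ^+ k * x^-1 ^+ k.-1 by apply: A_mul => //; apply: A_exp.
by rewrite exprVn -{1}(prednK k0) exprS mulfK // expf_neq0.
Qed.

Lemma maximal_subring_extension :
  exists2 w : W -> option L, is_valuation w & forall c, w (i c) = v c.
Proof.
have [w wP] := boolp.choice value_ex.
have w0 : w 0 = None by case wE: (w 0) (wP 0) => // /value_neq0; rewrite eqxx.
have wK c : w (i c) = v c.
  case vc: (v c) => [a|]; last first.
    by move/eqP: vc; rewrite (valuation_eq0 vP) => /eqP->; rewrite rmorph0.
  have c0 : i c != 0 by rewrite fmorph_eq0 -(valuation_eq0 vP) vc.
  have va : value (i c) (Some a).
    right; exists 1%N, c, a; rewrite invr1 scale1r; split=> //.
    by rewrite expr1 mulfV //; split; rewrite ?invr1 ?oner_neq0.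
  case wE: (w (i c)) (wP (i c)) => [b|] wc; first by rewrite (value_uniq wc va).
  by case: wc => [[/eqP]|[k [d [e [_ _ _]]]]//]; rewrite (negPf c0).
have wSome x : x != 0 -> exists b, w x = Some b.
  move=> x0; case wE: (w x) (wP x) => [b|]; first by exists b.
  by case=> [[/eqP]|[k [c [a [_ _ _]]]]//]; rewrite (negPf x0).
have wM x y : w (x * y) = addE (w x) (w y).
  have [->|x0] := eqVneq x 0; first by rewrite mul0r w0.
  have [->|y0] := eqVneq y 0; first by rewrite mulr0 w0; case: (w x).
  have [b wx] := wSome _ x0; have [b' wy] := wSome _ y0.
  have [b'' wxy] := wSome _ (mulf_neq0 x0 y0).
  move: (wP x) (wP y) (wP (x * y)); rewrite wx wy wxy /= => vx vy vxy.
  by rewrite (value_uniq vxy (value_M vx vy)).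
exists w => //; split=> // [x|x y].
  split=> [wx|->//]; apply/eqP; apply/negP => /negP /wSome[b].
  by rewrite wx.
wlog xy : x y / leE (w x) (w y) => [wl|].
  case/orP: (leE_total (w x) (w y)) => /wl //.
  rewrite [y + x]addrC; congr leE; rewrite /minE.
  case: ifP => yx; case: ifP => xy //; first exact: leE_anti.
  by have := leE_total (w x) (w y); rewrite xy yx.
rewrite /minE xy.
case: (eqVneq x 0) xy => [->|x0] xy.
  by move: xy; rewrite w0 add0r; case: (w y).
have [->|xy0] := eqVneq (x + y) 0; first by rewrite w0 leE_None.
have [->|y0] := eqVneq y 0; first by rewrite addr0 leExx.
have Ayx : A (1 + y / x).
  apply: A_add => //.
  have [c wyx] := wSome _ (mulf_neq0 y0 (invr_neq0 x0)).
  have := wP (y / x); rewrite wyx => /value_ge0 ->.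
  move: xy; rewrite -[y](mulfVK x0) wM wyx.
  by have [b ->] := wSome _ x0; rewrite /= -{1}[b]add0r leL_add2r.
have nz : 1 + y / x != 0.
  by rewrite -(mulfV x0) -mulrDl mulf_neq0 ?invr_eq0.
have [c wc] := wSome _ nz.
have := wP (1 + y / x); rewrite wc => /value_ge0 c0.
have -> : x + y = (1 + y / x) * x by rewrite mulrDl mul1r mulfVK.
rewrite wM wc; have [b ->] := wSome _ x0.
by rewrite /= -{1}[b]add0r leL_add2r; apply/c0.
Qed.

End Maximal.

Lemma valuation_extension : (forall x : W, algebraicOver i x) ->
  exists2 w : W -> option L, is_valuation w & forall c, w (i c) = v c.
Proof.
move=> algW.
(* Only nonempty sets are constrained, because Zorn's lemma also ranges over the empty chain, whose
   union is empty. *)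
pose P (A : classical_sets.set W) := (exists x, A x) -> subring_over A.
have [|A [PA Amax]] := @classical_sets.Zorn_bigcup W P.
  move=> F FP Ftot [x0 [A0 FA0 A0x0]].
  have sub A x : F A -> A x -> subring_over A by move=> FA Ax; apply: FP => //; exists x.
  have pair x y : classical_sets.bigcup F id x -> classical_sets.bigcup F id y ->
      exists A, [/\ F A, A x & A y].
    move=> [A FA Ax] [B FB By]; case: (Ftot A B FA FB) => [AB|BA].
      by exists B; split=> //; apply: AB.
    by exists A; split=> //; apply: BA.
  split=> [c|x y Fx Fy|x y Fx Fy].
  - split=> [[A FA Ac]|c0]; first by have [/(_ c)[+ _ _ _]] := sub _ _ FA Ac; apply.
    by exists A0 => //; have [/(_ c)[_ +] _ _] := sub _ _ FA0 A0x0; apply.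
  - have [A [FA Ax Ay]] := pair _ _ Fx Fy; exists A => //.
    by have [_ + _] := sub _ _ FA Ax; apply.
  - have [A [FA Ax Ay]] := pair _ _ Fx Fy; exists A => //.
    by have [_ _] := sub _ _ FA Ax; apply.
(* The image of the valuation ring of [v] is admissible and shows that the maximal set is not the
   empty one. *)
pose O x := exists2 c, leE (Some 0) (v c) & x = i c.
have rv := valuation_ring vP.
have O_over : subring_over O.
  split=> [c|_ _ [c c0 ->] [d d0 ->]|_ _ [c c0 ->] [d d0 ->]].
  - by split=> [[d d0 /fmorph_inj->]|c0] //; exists c.
  - by exists (c - d); rewrite ?rmorphB // val_leD ?valN.
  - exists (c * d); rewrite ?rmorphM //; have [_ _ -> _] := rv.
    by rewrite -[Some 0](addE0) leED.
have Aex : exists x, A x.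
  apply: boolp.contrapT => A0.
  have O1 : O 1 by exists 1; rewrite ?rmorph1 // (valuation1 vP) leExx.
  apply: (Amax O) => //; split.
    by move=> x Ax; case: A0; exists x.
  by move=> /(_ 1 O1) A1; case: A0; exists 1.
apply: (maximal_subring_extension (PA Aex)) => // B B_over AB x Bx.
apply: boolp.contrapT => nAx; apply: (Amax B) => //.
by split=> // /(_ x Bx).
Qed.

End Chevalley.

(** * Conjugates over a henselian field *)

Section SymmetricFunctions.
Variables (K W : fieldType) (i : {rmorphism K -> W}) (n : nat) (t : 'I_n -> W).
Variable f : {poly K}.
Hypothesis fE : map_poly i f = \prod_(k < n) ('X - (t k)%:P).

(** The fundamental theorem reduces this to elementary symmetric polynomials, whose values at the
    roots are coefficients of [f] up to sign. *)
Lemma symmetric_eval (p : {mpoly K[n]}) : p \is symmetric -> exists a, mmap i t p = i a.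
Proof.
move=> /sym_fundamental [q [<- _]].
have symE (k : 'I_n) : mmap i t (mesym n K k.+1) = i ((-1) ^+ k.+1 * f`_(n - k.+1)).
  have := mroots_coeff [tuple t j | j < n] (lift ord0 k).
  rewrite big_tuple (eq_bigr (fun j => 'X - (t j)%:P)); last first.
    by move=> j _; rewrite tnth_mktuple.
  rewrite -fE coef_map /= => tE; rewrite rmorphM rmorphXn rmorphN1 tE.
  rewrite mulrA -expr2 sqrr_sign mul1r /mesym !raddf_sum /=; apply: eq_bigr => h _.
  rewrite !rmorph_prod /=; apply: eq_bigr => j _.
  by rewrite mmapX mmap1U mevalXU tnth_mktuple.
exists (q.@[fun k : 'I_n => (-1) ^+ k.+1 * f`_(n - k.+1)]).
rewrite comp_mpolyE mevalE !rmorph_sum /=; apply: eq_bigr => m _.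
rewrite mmapZ rmorphM !rmorph_prod /=; congr (_ * _); apply: eq_bigr => k _.
by rewrite !rmorphXn /= tnth_mktuple symE.
Qed.

Lemma symmetric_poly_eval (p : {poly {mpoly K[n]}}) :
  (forall s, map_poly (msym s) p = p) ->
  exists p0, map_poly (mmap i t) p = map_poly i p0.
Proof.
move=> psym.
have sym_coef j : exists a, mmap i t p`_j = i a.
  by apply: symmetric_eval; apply/issymP => s; rewrite -coef_map psym.
have [a aE] := boolp.choice sym_coef.
exists (\poly_(j < size p) a j); apply/polyP => j.
rewrite !coef_map coef_poly /= aE; case: ltnP => // pj.
by rewrite -aE nth_default ?rmorph0.
Qed.

(** [g] at a formal root. Permuting the variables replaces a Galois action; the roots [t k] may
    repeat, so inseparable [f] are covered. *)
Definition mpoly_at (g : {poly K}) (k : 'I_n) : {mpoly K[n]} :=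
  (map_poly (@mpolyC n K) g).['X_k].

Lemma msym_mpoly_at s g k : msym s (mpoly_at g k) = mpoly_at g (s k).
Proof.
rewrite /mpoly_at -horner_map /= /msym mmapX mmap1U -map_poly_comp /=.
by congr (_.[_]); apply: eq_map_poly => c /=; rewrite mmapC.
Qed.

Lemma mmap_mpoly_at g k : mmap i t (mpoly_at g k) = (map_poly i g).[t k].
Proof.
rewrite /mpoly_at -horner_map /= mmapX mmap1U -map_poly_comp /=.
by congr (_.[_]); apply: eq_map_poly => c /=; rewrite mmapC.
Qed.

End SymmetricFunctions.

Lemma reindex_imset (R : Type) (idx : R) (op : Monoid.com_law idx) (n r : nat)
    (s : 'S_n) (Q : pred {set 'I_n}) (F : {set 'I_n} -> R) :
  \big[op/idx]_(I : {set 'I_n} | (#|I| == r) && Q (s @: I)) F (s @: I) =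
  \big[op/idx]_(I : {set 'I_n} | (#|I| == r) && Q I) F I.
Proof.
rewrite [RHS](reindex (fun I : {set 'I_n} => s @: I)) /=.
  by apply: eq_bigl => I; rewrite card_imset //; apply: perm_inj.
exists (fun I : {set 'I_n} => (s^-1)%g @: I) => I _; rewrite -imset_comp.
  by rewrite (eq_imset (g := id)) ?imset_id // => k /=; rewrite permK.
by rewrite (eq_imset (g := id)) ?imset_id // => k /=; rewrite permKV.
Qed.

Lemma reindex_imset_card (R : Type) (idx : R) (op : Monoid.com_law idx) (n r : nat)
    (s : 'S_n) (F : {set 'I_n} -> R) :
  \big[op/idx]_(I : {set 'I_n} | #|I| == r) F (s @: I) =
  \big[op/idx]_(I : {set 'I_n} | #|I| == r) F I.
Proof.
have := reindex_imset op r s predT F.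
by under eq_bigl do rewrite /= andbT; under [RHS]eq_bigl do rewrite /= andbT.
Qed.

Lemma leL_sum (L : divOrdGroup) (I : Type) (r : seq I) (P : pred I) (F G : I -> L) :
  (forall k, P k -> leL (F k) (G k)) ->
  leL (\sum_(k <- r | P k) F k) (\sum_(k <- r | P k) G k).
Proof.
by move=> FG; elim/big_rec2: _ => [|k x y Pk xy]; [apply: leLL | apply: leLD; rewrite ?FG].
Qed.

Section IntegralPolynomials.
Variables (W : fieldType) (L : divOrdGroup) (w : W -> option L).
Hypothesis wP : is_valuation w.

Definition integral_coefs (p : {poly W}) : Prop := forall j, leE (Some 0) (w p`_j).

Let wr := valuation_ring wP.

Lemma integral_coefsM p q :
  integral_coefs p -> integral_coefs q -> integral_coefs (p * q).
Proof.
move=> ip iq j; rewrite coefM; apply: (val_sum_le wr) => k _.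
by have [_ _ -> _] := wr; rewrite -[Some 0](addE0) leED.
Qed.

Lemma integral_coefs_XsubC y : leE (Some 0) (w y) -> integral_coefs ('X - y%:P).
Proof.
move=> y0 j; have [w0 w1 _ _] := wr; rewrite coefB coefX coefC.
apply: (val_leD wr); first by case: (j == 1%N); rewrite ?w0 ?w1 ?leExx ?leE_None.
by rewrite (valN wr); case: (j == 0%N); rewrite ?w0 ?leE_None.
Qed.

Lemma integral_coefs1 : integral_coefs 1.
Proof.
by move=> j; have [w0 w1 _ _] := wr; rewrite coef1; case: (j == 0%N); rewrite ?w0 ?w1 ?leExx ?leE_None.
Qed.

Lemma integral_coefs_deriv1 p : integral_coefs p -> leE (Some 0) (w p^`().[1]).
Proof.
move=> ip; rewrite horner_coef; apply: (val_sum_le wr) => k _.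
rewrite expr1n mulr1 coef_deriv; move: (p`_k.+1) (ip k.+1) => z z0.
elim: k.+1 => [|l IH].
  by have [-> _ _ _] := wr; rewrite leE_None.
by rewrite mulrS; apply: (val_leD wr).
Qed.

End IntegralPolynomials.

Section Conjugates.
Variables (K W : fieldType) (L : divOrdGroup) (i : {rmorphism K -> W}).
Variables (v : K -> option L) (w : W -> option L).
Hypotheses (vP : is_valuation v) (wP : is_valuation w).
Hypotheses (wi : forall c, w (i c) = v c) (hens : henselian v).
Variables (n : nat) (t : 'I_n -> W) (f : {poly K}).
Hypothesis fE : map_poly i f = \prod_(k < n) ('X - (t k)%:P).
Hypothesis f_irr : irreducible_poly f.
Variable g : {poly K}.
Let x k := (map_poly i g).[t k].
Hypothesis x_neq0 : forall k, x k != 0.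

Let wr := valuation_ring wP.
Let wM y z : w (y * z) = addE (w y) (w z). Proof. by have [] := wr. Qed.

Let xm (I : {set 'I_n}) : {mpoly K[n]} := \prod_(k in I) mpoly_at g k.
Let X (I : {set 'I_n}) : W := \prod_(k in I) x k.

Let msym_xm s I : msym s (xm I) = xm (s @: I).
Proof.
rewrite /xm rmorph_prod /= big_imset /=; last by move=> ? ? _ _; apply: perm_inj.
by apply: eq_bigr => k _; rewrite msym_mpoly_at.
Qed.

Let mmap_xm I : mmap i t (xm I) = X I.
Proof. by rewrite /xm rmorph_prod /=; apply: eq_bigr => k _; apply: mmap_mpoly_at. Qed.

(* Hensel's lemma puts the dominant product in [K]; the factor of [f] with
   roots [t k], [k \in Is], is then recovered by Lagrange interpolation. *)
Lemma dominant_subset_full (Is : {set 'I_n}) : (0 < #|Is|)%N ->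
  (forall J : {set 'I_n}, #|J| = #|Is| -> J != Is -> ltE (w (X Is)) (w (X J))) ->
  #|Is| = n.
Proof.
set r := #|Is| => r_gt0 dom.
have XIs0 : X Is != 0 by apply/prodf_neq0 => k _; apply: x_neq0.
have [m wXIs] : exists m, w (X Is) = Some m.
  by case wX: (w (X Is)) => [m|]; [exists m | move/eqP: wX; rewrite (valuation_eq0 wP) (negPf XIs0)].
rewrite wXIs in dom.
have Isr : #|Is| == r by [].
(* The sum of all products of [r] conjugates is in [K] and has the value of its unique least term
   [X Is], hence can normalise the products. *)
have [a aE] : exists a, \sum_(I : {set 'I_n} | #|I| == r) X I = i a.
  have [|a aE] := symmetric_eval fE (p := \sum_(I : {set 'I_n} | #|I| == r) xm I).
    apply/issymP => s; rewrite rmorph_sum /=.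
    under eq_bigr do rewrite msym_xm.
    exact: (reindex_imset_card _ r s xm).
  by exists a; rewrite -aE rmorph_sum /=; apply: eq_bigr => I _; rewrite mmap_xm.
have restE : ltE (Some m) (w (\sum_(I : {set 'I_n} | (#|I| == r) && (I != Is)) X I)).
  by apply: (val_sum_lt wr) => I /andP[/eqP Ir II]; apply: dom.
have aD := aE; rewrite (bigD1 Is) //= in aD.
have wa : w (i a) = Some m by rewrite -aD; apply: val_addl.
have ia0 : i a != 0 by rewrite -(valuation_eq0 wP) wa.
have waV : w (i a)^-1 = Some (- m) by apply: valuationV.
(* Residually [y Is] is 1 and every other [y I] is 0. So 1 is a simple residual root of the product
   of the ['X - y I], a polynomial with coefficients in [K]. *)
pose y I := (i a)^-1 * X I.
have wy I : w (y I) = addE (w (X I)) (Some (- m)) by rewrite /y wM waV addEC.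
have wyIs : w (y Is) = Some 0 by rewrite wy wXIs /= subrr.
have wy_gt0 (I : {set 'I_n}) : #|I| == r -> I != Is -> ltE (Some 0) (w (y I)).
  by move=> /eqP Ir II; rewrite wy ltE_subr sub0r opprK; apply: dom.
have wy_ge0 (I : {set 'I_n}) : #|I| == r -> leE (Some 0) (w (y I)).
  move=> Ir; have [->|II] := eqVneq I Is; first by rewrite wyIs leExx.
  exact/ltEW/wy_gt0.
have [p0 p0E] : exists p0, \prod_(I : {set 'I_n} | #|I| == r) ('X - (y I)%:P) = map_poly i p0.
  pose p : {poly {mpoly K[n]}} :=
    \prod_(I : {set 'I_n} | #|I| == r) ('X - ((a^-1)%:MP * xm I)%:P).
  have [|p0 p0E] := symmetric_poly_eval fE (p := p).
    move=> s; rewrite /p rmorph_prod /=.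
    under eq_bigr do rewrite rmorphB /= map_polyX map_polyC /= rmorphM /= msym_xm /msym mmapC.
    exact: (reindex_imset_card _ r s (fun I => 'X - ((a^-1)%:MP * xm I)%:P)).
  exists p0; rewrite -p0E /p rmorph_prod /=; apply: eq_bigr => I _.
  by rewrite rmorphB /= map_polyX map_polyC /= [mmap i t _]rmorphM /= mmap_xm mmapC /y -fmorphV.
pose R := \prod_(I : {set 'I_n} | (#|I| == r) && (I != Is)) ('X - (y I)%:P).
have p0R : map_poly i p0 = ('X - (y Is)%:P) * R by rewrite -p0E (bigD1 Is).
have R_int : integral_coefs w R.
  rewrite /R; elim/big_rec: _ => [|I q /andP[Ir _] qi]; first exact: integral_coefs1.
  by apply: integral_coefsM => //; apply: integral_coefs_XsubC => //; apply: wy_ge0.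
have p0_int : integral_coefs w (map_poly i p0).
  by rewrite p0R; apply: integral_coefsM => //; apply: integral_coefs_XsubC => //; rewrite wyIs leExx.
have w1 : w 1 = Some 0 by have [] := wr.
have w1y : ltE (Some 0) (w (1 - y Is)).
  have -> : 1 - y Is = (i a)^-1 * \sum_(I : {set 'I_n} | (#|I| == r) && (I != Is)) X I.
    rewrite /y -[1](mulVf ia0) -mulrBr; congr (_ * _).
    by rewrite -aD addrAC subrr add0r.
  by rewrite wM waV addEC ltE_subr sub0r opprK.
have wR1 : w R.[1] = Some 0.
  rewrite /R horner_prod (val_prod wr); apply: big1 => I /andP[Ir II].
  rewrite hornerXsubC; apply: (val_addl wr) => //.
  by rewrite (valN wr); apply: wy_gt0.
have [b [p0b vb]] : exists b, p0.[b] = 0 /\ ltE (Some 0) (v (b - 1)).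
  apply: hens.
  - rewrite -(map_monic i) -p0E; apply: monic_prod => I _; apply: monicXsubC.
  - by move=> j; rewrite -wi -coef_map.
  - by rewrite (valuation1 vP) leExx.
  - rewrite -wi -horner_map /= rmorph1 p0R hornerM hornerXsubC wM wR1 addE0.
    exact: w1y.
  - rewrite -wi -horner_map /= rmorph1 -deriv_map p0R derivM derivXsubC mul1r.
    rewrite hornerD hornerM hornerXsubC; apply: (val_addl wr) => //.
    by have := ltE_leD w1y (integral_coefs_deriv1 wP R_int); rewrite addr0 -wM.
(* The lifted root is one of the [y I], and being congruent to 1 it has value 0, which leaves only
   [Is]. *)
have ibIs : i b = y Is.
  have : (map_poly i p0).[i b] == 0 by rewrite horner_map p0b rmorph0.
  rewrite -p0E horner_prod => /prodf_eq0[I Ir].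
  rewrite hornerXsubC subr_eq0 => /eqP ibI.
  have [<-//|II] := eqVneq I Is.
  have := wy_gt0 I Ir II; rewrite -ibI wi.
  have -> : v b = Some 0.
    rewrite -[b](subrK 1) addrC; apply: (val_addl (valuation_ring vP)) => //.
    exact: valuation1.
  by rewrite ltE_irr.
have icE : mmap i t (a * b)%:MP = X Is by rewrite mmapC /= rmorphM ibIs /y mulVKf.
(* Interpolation without denominators. At the roots [a * b] becomes [X Is], so every summand with
   [I != Is] acquires a zero factor, from [J = Is]; what remains is the factor of [f] carried by
   [Is], times the nonzero scalar [kap]. Symmetry of [G] puts it over [K]. *)
pose G : {poly {mpoly K[n]}} := \sum_(I : {set 'I_n} | #|I| == r)
  (\prod_(k in I) ('X - ('X_k)%:P)) *
  (\prod_(J : {set 'I_n} | (#|J| == r) && (J != I)) ((a * b)%:MP - xm J))%:P.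
have [|G0 GE] := symmetric_poly_eval fE (p := G).
  move=> s; rewrite /G rmorph_sum /=.
  pose F (I : {set 'I_n}) := (\prod_(k in I) ('X - ('X_k)%:P)) *
    (\prod_(J : {set 'I_n} | (#|J| == r) && (J != I)) ((a * b)%:MP - xm J))%:P : {poly {mpoly K[n]}}.
  rewrite -[RHS](reindex_imset_card _ r s F); apply: eq_bigr => I _; rewrite /F rmorphM /= map_polyC /=.
  congr (_ * _%:P).
    rewrite rmorph_prod /= big_imset /=; last by move=> ? ? _ _; apply: perm_inj.
    apply: eq_bigr => k _.
    by rewrite rmorphB /= map_polyX map_polyC /= /msym mmapX mmap1U.
  rewrite rmorph_prod /= -(@reindex_imset _ 1 *%R n r s (fun J => J != s @: I) (fun J => (a * b)%:MP - xm J)).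
  apply: eq_big => [J|J _]; last by rewrite rmorphB /= msym_xm /msym mmapC.
  by rewrite (inj_eq (imset_inj (@perm_inj _ s))).
pose H := \prod_(k in Is) ('X - (t k)%:P).
pose kap := \prod_(J : {set 'I_n} | (#|J| == r) && (J != Is)) (X Is - X J).
have kap0 : kap != 0.
  apply/prodf_neq0 => J /andP[/eqP Jr JI]; rewrite subr_eq0.
  by apply/eqP => XX; have := dom J Jr JI; rewrite -XX wXIs ltE_irr.
have {GE} GE : map_poly i G0 = kap *: H.
  rewrite -GE /G rmorph_sum /= (bigD1 Is) //= [X in _ + X]big1 ?addr0.
    rewrite rmorphM /= map_polyC /= [LHS]mulrC mul_polyC; congr (_ *: _).
      rewrite rmorph_prod /=; apply: eq_bigr => J _.
      by rewrite rmorphB /= icE mmap_xm.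
    rewrite rmorph_prod /=; apply: eq_bigr => k _.
    by rewrite rmorphB /= map_polyX map_polyC /= mmapX mmap1U.
  move=> I /andP[Ir II]; rewrite rmorphM /= map_polyC /= [mmap _ _ _]rmorph_prod /=.
  rewrite [X in X%:P](bigD1 Is) ?Isr 1?eq_sym //= rmorphB /= icE mmap_xm subrr.
  by rewrite mul0r mulr0.
have szH : size H = r.+1.
  by rewrite /H -big_enum size_prod_XsubC -cardE.
have szG0 : size G0 = r.+1 by rewrite -(size_map_poly i) GE size_scale.
have szf : size f = n.+1.
  by rewrite -(size_map_poly i) fE (eq_bigl (mem 'I_n)) // -big_enum size_prod_XsubC -cardE card_ord.
have G0f : G0 %| f.
  rewrite -(dvdp_map i) GE dvdpZl // fE (bigID (mem Is)) /=.
  exact: dvdp_mulr.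
have [_ /(_ G0)] := f_irr; rewrite szG0 eqSS -lt0n => /(_ r_gt0 G0f)/eqp_size.
by rewrite szG0 szf => -[].
Qed.

(** The indices of least value form a dominant subset: any other subset of the same size has an
    index outside it, which raises the value of the product. Being dominant, it contains all
    indices. *)
Lemma conjugate_values k l : w (x k) = w (x l).
Proof.
have wx j : exists b, w (x j) = Some b.
  case wE: (w (x j)) => [b|]; first by exists b.
  by move/eqP: wE; rewrite (valuation_eq0 wP) (negPf (x_neq0 j)).
have [b bE] := boolp.choice wx.
have [k0 _ b_min] := @extremumP _ _ (@leL L) k xpredT b (@leLL L)
  (@leL_trans L) (@leL_total L) isT.
pose Is := [set j | b j == b k0].
have wX (J : {set 'I_n}) : w (X J) = Some (\sum_(j in J) b j).
  rewrite (val_prod wr) (eq_bigr (fun j => Some (b j))); last by move=> j _; apply: bE.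
  by elim/big_rec2: _ => // j y z _ ->.
have k0Is : k0 \in Is by rewrite inE.
have Is_full : #|Is| = n.
  apply: dominant_subset_full => [|J JI JIs]; first by apply/card_gt0P; exists k0.
  have /subsetPn[j jJ jIs] : ~~ (J \subset Is).
    by apply: contra JIs => sJI; rewrite eqEcard sJI JI leqnn.
  have bj : ltE (Some (b k0)) (Some (b j)).
    rewrite /ltE /= [leL _ _]b_min // andbT; apply: contra jIs => /eqP[bj].
    by rewrite inE bj.
  rewrite !wX (eq_bigr (fun=> b k0)); last by move=> a; rewrite inE => /eqP.
  rewrite sumr_const -JI -sumr_const (bigD1 j) //= [X in ltE _ (Some X)](bigD1 j) //=.
  apply: (ltE_leD (y := Some (b j)) (t := Some (\sum_(a in J | a != j) b a))) => //=.
  by apply: leL_sum => a _; apply: b_min.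
have IsT : Is = [set: 'I_n] by apply/eqP; rewrite eqEcard subsetT cardsT card_ord Is_full leqnn.
have bk0 j : b j = b k0 by have := in_setT j; rewrite -IsT inE => /eqP.
by rewrite !bE !bk0.
Qed.

End Conjugates.

(** * Splitting fields *)

Lemma irreducible_factor (K : fieldType) (p : {poly K}) : (1 < size p)%N ->
  exists2 q, irreducible_poly q & q %| p.
Proof.
move: {2}(size p) (leqnn (size p)) => n; elim: n p => [|n IH] p; first by case: (size p).
move=> pn p1; have p0 : p != 0 by rewrite -size_poly_gt0 ltnW.
have [irr|nirr] := boolp.pselect (irreducible_poly p); first by exists p.
have [q [q1 qp nqp]] : exists q : {poly K}, [/\ size q != 1%N, q %| p & ~ q %= p].
  apply: boolp.contrapT => noq; apply: nirr; split=> // q q1 qp.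
  by apply: boolp.contrapT => nqp; apply: noq; exists q.
have q0 : q != 0 by apply: contraTneq qp => ->; rewrite dvd0p.
have qsz : (1 < size q)%N by rewrite ltn_neqAle eq_sym q1 size_poly_gt0.
have szqp : (size q < size p)%N.
  rewrite ltn_neqAle dvdp_leq // andbT; apply/negP => /eqP szE; apply: nqp.
  by rewrite -dvdp_size_eqp // szE.
have [r irr rq] := IH q (leq_trans szqp pn) qsz.
by exists r => //; apply: dvdp_trans qp.
Qed.

Lemma fieldExt_algebraic (K : fieldType) (E : fieldExtType K) (x : E) :
  algebraicOver (in_alg E) x.
Proof.
have /polyOver1P[p pE] := minPolyOver 1%AS x.
exists p; last by rewrite -pE root_minPoly.
by rewrite -(map_poly_eq0 (in_alg E)) -pE monic_neq0 // monic_minPoly.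
Qed.

(** Each adjunction of a root changes the base field, so [W] is tied to [K] by a morphism.
    Algebraicity is carried along for the sake of [valuation_extension]. *)
Lemma splitting_field_exists (K : fieldType) (p : {poly K}) : p != 0 ->
  exists (W : fieldType) (i : {rmorphism K -> W}),
    (forall x, algebraicOver i x) /\
    exists rs, map_poly i p = i (lead_coef p) *: \prod_(r <- rs) ('X - r%:P).
Proof.
move: {2}(size p) (leqnn (size p)) => n.
elim: n K p => [|n IH] K p pn p0; first by move: pn; rewrite leqn0 size_poly_eq0 (negPf p0).
have [p1|p1] := leqP (size p) 1.
  exists K, idfun; split; first by move=> x; apply: algebraic_id.
  exists [::]; rewrite big_nil map_poly_id // {1}(size1_polyC p1) alg_polyC.
  by rewrite lead_coefE (size1_polyC p1) size_polyC; case: eqP => //= ->.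
have [q irr qp] := irreducible_factor p1.
have [E _ [z qz _]] := irredp_FAdjoin irr.
have pz : root (map_poly (in_alg E) p) z.
  have /dvdpP[r ->] := qp; by rewrite rmorphM rootM qz orbT.
have /factor_theorem[p' p'E] := pz.
have p'0 : p' != 0.
  apply: contraNneq p0 => p'0; move/eqP: p'E.
  by rewrite p'0 mul0r map_poly_eq0.
have szp' : size p = (size p').+1.
  by rewrite -(size_map_poly (in_alg E)) p'E size_Mmonic ?monicXsubC // size_XsubC addn2.
have [|W [i [algi [rs p'rs]]]] := IH E p' _ p'0; first by rewrite -ltnS -szp'.
exists W, (i \o in_alg E); split.
  move=> x; apply/integral_algebraic; have [r r0 rx] := algi x.
  apply: (integral_root (p := map_poly i r)) => //; first by rewrite map_poly_eq0.
  apply/integral_poly => j; rewrite coef_map /=; apply: integral_rmorph.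
  exact/integral_algebraic/fieldExt_algebraic.
exists (i z :: rs).
rewrite map_poly_comp /= p'E rmorphM /= p'rs rmorphB /= map_polyX map_polyC big_cons.
rewrite -scalerAl mulrC; congr (_ *: _); congr (i _).
by have := lead_coef_map (in_alg E) p; rewrite p'E lead_coef_Mmonic ?monicXsubC.
Qed.

(** * Levels and key polynomials *)

Section Levels.
Variable L : divOrdGroup.
Implicit Types x y z : lvl L.

Lemma lvl_le_trans y x z : lvl_le x y -> lvl_le y z -> lvl_le x z.
Proof. by case: x y z => [|a|] [|b|] [|c|] //=; apply: leL_trans. Qed.

Lemma lvl_le_total x y : lvl_le x y || lvl_le y x.
Proof. by case: x y => [|a|] [|b|] //=; apply: leL_total. Qed.

Lemma lvl_le_maxl x y : lvl_le x (lvl_max x y).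
Proof.
rewrite /lvl_max; case: ifP => // _.
by case: x => //= a; apply: leLL.
Qed.

Lemma lvl_le_maxr x y : lvl_le y (lvl_max x y).
Proof.
rewrite /lvl_max; case: ifP => [_|xy]; first by case: y => //= a; apply: leLL.
by have := lvl_le_total x y; rewrite xy.
Qed.

Lemma foldr_lvl_max_ge (F : nat -> lvl L) (r : seq nat) i : i \in r ->
  lvl_le (F i) (foldr (@lvl_max L) (LMinus L) [seq F s | s <- r]).
Proof.
elim: r => //= j r IH; rewrite inE => /orP[/eqP-> | /IH ir]; first exact: lvl_le_maxl.
by apply: lvl_le_trans ir _; apply: lvl_le_maxr.
Qed.

Lemma foldr_lvl_max_attained (F : nat -> lvl L) (r : seq nat) :
  foldr (@lvl_max L) (LMinus L) [seq F s | s <- r] = LMinus L \/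
  exists2 i, i \in r & foldr (@lvl_max L) (LMinus L) [seq F s | s <- r] = F i.
Proof.
elim: r => [|j r IH] /=; first by left.
move: IH; set G := foldr _ _ _ => IH; right; rewrite /lvl_max; case: ifP => [|_]; last by exists j; rewrite ?mem_head.
case: IH => [-> | [i ir ->]]; last by exists i; rewrite ?inE ?ir ?orbT.
by case Fj: (F j) => // _; exists j; rewrite ?mem_head.
Qed.

Lemma scale_natV_le (e a b : L) s : (0 < s)%N ->
  leL ((s%:R : rat)^-1 *: (a - b)) e = leL a (b + e *+ s).
Proof.
move=> s0; rewrite -(leL_pmuln _ _ s0) -scaler_nat scalerA mulfV ?scale1r.
  by rewrite -(leL_add2r b) subrK addrC.
by rewrite Num.Theory.pnatr_eq0 -lt0n.
Qed.

Lemma scale_natV_ge (e a b : L) s : (0 < s)%N ->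
  leL e ((s%:R : rat)^-1 *: (a - b)) = leL (b + e *+ s) a.
Proof.
move=> s0; rewrite -(leL_pmuln _ _ s0) -[X in leL _ X]scaler_nat scalerA mulfV ?scale1r.
  by rewrite -(leL_add2r b) subrK addrC.
by rewrite Num.Theory.pnatr_eq0 -lt0n.
Qed.

End Levels.

Section Taylor.
Variable K : fieldType.
Implicit Types p q : {poly K}.

(** This is [p (x + y)] with [y] as the outer and [x] as the inner variable; as a composition it is
    a ring morphism in [p]. *)
Definition taylor p : {poly {poly K}} := p^:P \Po ('X + 'X%:P).

Lemma taylorM p q : taylor (p * q) = taylor p * taylor q.
Proof. by rewrite /taylor rmorphM /= comp_polyM. Qed.

Lemma taylorD p q : taylor (p + q) = taylor p + taylor q.
Proof. by rewrite /taylor rmorphD /= comp_polyD. Qed.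

Lemma taylor0 : taylor 0 = 0.
Proof. by rewrite /taylor rmorph0 comp_poly0. Qed.

Lemma taylor1 : taylor 1 = 1.
Proof. by rewrite /taylor rmorph1 comp_polyC. Qed.

Lemma coef_taylor p s : (taylor p)`_s = hasse s p.
Proof.
rewrite /taylor /comp_poly addrC nderiv_taylor; last exact: mulrC.
have -> : \sum_(i < size p^:P^:P) (p^:P^:P^`N(i)).['X%:P] * 'X^i =
          \poly_(i < size p) p^`N(i).
  rewrite poly_def !size_map_polyC; apply: eq_bigr => i _.
  rewrite !nderivn_map horner_map /= mul_polyC; congr (_ *: _).
  exact: comp_polyXr.
by rewrite coef_poly /hasse; case: ltnP => // /nderivn_poly0->.
Qed.

End Taylor.

Section KeyPolynomials.
Variables (K : fieldType) (L : divOrdGroup) (v : K -> option L).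
Variable nu : {poly K} -> option L.
Hypotheses (vP : is_valuation v) (nuP : is_poly_valuation v nu).

Lemma poly_valuation_ring : ring_valuation nu.
Proof. by case: nuP. Qed.

Lemma nuC a : nu a%:P = v a. Proof. by case: nuP. Qed.

Lemma valuation_neq0 a : a != 0 -> exists c, v a = Some c.
Proof.
case vaE : (v a) => [c|] ; first by exists c.
by case: vP => /(_ a) [/(_ vaE) ->]; rewrite eqxx.
Qed.

(* [e] is the level of the key polynomial [Q], and [d] is the largest [s] with
   [(nu Q - nu (hasse s Q)) / s = e]. *)
Definition gauss_key (e : L) (d : nat) (Q : {poly K}) (q : L) : Prop :=
  [/\ (0 < d)%N, nu Q = Some q, gauss_dom nu e (taylor Q) q d &
      forall g : {poly K}, g != 0 -> (size g < size Q)%N ->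
        exists2 c, nu g = Some c & gauss_dom nu e (taylor g) c 0].

(** For [s > 0], [(nu p - nu (hasse s p)) / s <= e] means [nu p <= nu (hasse s p) + s e]. So the
    maximum defining the level [e] of [Q] is a tie between [s = 0] and some [s > 0], whereas a level
    below [e] leaves [s = 0] as the only dominant term. *)
Lemma key_poly_gauss Q q : key_poly nu Q -> (1 < size Q)%N -> nu Q = Some q ->
  exists e d, gauss_key e d Q q.
Proof.
move=> [Qmon keyQ] szQ nuQ.
have [nu0 nu1 _ _] := poly_valuation_ring.
have hasse_big s (p : {poly K}) : (size p <= s)%N -> nu (hasse s p) = None.
  by move=> ps; rewrite /hasse nderivn_poly0.
have memr s (p : {poly K}) : (0 < s)%N -> (s < size p)%N -> s \in iota 1 (size p).-1.
  by case: (size p) => // n s0 sn; rewrite mem_iota s0 add1n.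
pose F s := match nu (hasse s Q) with
             | None => LMinus L
             | Some b => LFin ((s%:R : rat)^-1 *: (q - b))
             end.
have lvlQ : level nu Q = foldr (@lvl_max L) (LMinus L) [seq F s | s <- iota 1 (size Q).-1].
  by rewrite /level leqNgt szQ /= nuQ.
(* This derivative has value 0, which keeps the level of [Q] from being minus infinity. *)
have topQ : hasse (size Q).-1 Q = 1.
  apply/polyP => i; rewrite coef_nderivn coef1; case: i => [|i].
    by rewrite addn0 binn mulr1n -[Q`__]/(lead_coef Q) (monicP Qmon).
  by rewrite addnS nth_default ?mul0rn // -addSn prednK ?leq_addr // ltnW.
have szQ1 : (0 < (size Q).-1)%N by rewrite -ltnS prednK // ltnW.
have topr : (size Q).-1 \in iota 1 (size Q).-1 by rewrite memr // prednK // ltnW.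
have [e lvlE] : exists e, level nu Q = LFin e.
  have := foldr_lvl_max_ge F topr; rewrite -lvlQ {1}/F topQ nu1.
  have := foldr_lvl_max_attained F (iota 1 (size Q).-1); rewrite -lvlQ.
  case: (level nu Q) => [|e|] //; first by exists e.
  by case=> // -[i _]; rewrite /F; case: (nu _).
have Qle s : (0 < s)%N -> leE (Some q) (addE (nu (hasse s Q)) (Some (e *+ s))).
  move=> s0; have [sQ|Qs] := ltnP s (size Q); last by rewrite hasse_big.
  have := foldr_lvl_max_ge F (memr _ _ s0 sQ); rewrite -lvlQ lvlE /F.
  by case: (nu _) => //= b; rewrite scale_natV_le.
have gtermQ s : gterm nu e (taylor Q) s = addE (nu (hasse s Q)) (Some (e *+ s)).
  by rewrite /gterm coef_taylor.
have [s0 s0_gt0 s0E] : exists2 s, (0 < s)%N & gterm nu e (taylor Q) s == Some q.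
  have := foldr_lvl_max_attained F (iota 1 (size Q).-1); rewrite -lvlQ lvlE.
  case=> // -[i]; rewrite mem_iota => /andP[i0 _]; rewrite /F => Fi.
  exists i => //; rewrite gtermQ; apply/eqP/leE_anti; last exact: Qle.
  by case: (nu _) Fi => // b [->] /=; rewrite -scale_natV_ge // leLL.
pose P s := gterm nu e (taylor Q) s == Some q.
have Pub s : P s -> (s <= size Q)%N.
  by rewrite leqNgt /P gtermQ; apply: contraL => /ltnW/hasse_big->.
have [d /eqP Pd dmax] := ex_maxnP (ex_intro P s0 s0E) Pub.
have Qle0 s : leE (Some q) (gterm nu e (taylor Q) s).
  rewrite gtermQ; case: s => [|s]; last exact: Qle.
  by rewrite /hasse nderivn0 nuQ mulr0n addE0 leExx.
exists e, d; split=> //.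
- by apply: leq_trans s0_gt0 (dmax _ s0E).
- split=> // s ds; rewrite /ltE Qle0 andbT; apply/eqP => /esym/eqP/dmax.
  by rewrite leqNgt ds.
move=> g g0 szg.
have [c nug glt] : exists2 c, nu g = Some c &
    forall s, (0 < s)%N -> ltE (Some c) (addE (nu (hasse s g)) (Some (e *+ s))).
  have := keyQ g szg; rewrite lvlE /level; case: leqP => [szg1 _|szg1 lt_e].
    rewrite (size1_polyC szg1) in g0 *; rewrite nuC.
    have [c ->] : exists c, v g`_0 = Some c by apply: valuation_neq0; rewrite -polyC_eq0.
    by exists c => // s sgt0; rewrite /hasse nderivnC gtn_eqF // nu0.
  case nug: (nu g) lt_e => [c|] // lt_e; exists c => // s sgt0.
  have [sg|gs] := ltnP s (size g); last by rewrite hasse_big.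
  move: lt_e; rewrite /lvl_lt => /andP[_]; set G := foldr _ _ _ => nleG.
  have := foldr_lvl_max_ge (fun s => match nu (hasse s g) with
             | None => LMinus L
             | Some b => LFin ((s%:R : rat)^-1 *: (c - b))
             end) (memr _ _ sgt0 sg); rewrite -/G.
  case: (nu (hasse s g)) => // b bG; rewrite ltEN.
  apply: contra nleG => eb; apply: lvl_le_trans bG.
  by rewrite /lvl_le scale_natV_ge.
exists c => //; split=> [|s|s sgt0]; rewrite /gterm coef_taylor.
- by rewrite /hasse nderivn0 nug mulr0n addE0.
- case: s => [|s]; first by rewrite /hasse nderivn0 nug mulr0n addE0 leExx.
  exact/ltEW/glt.
- exact: glt.
Qed.

(** [R - Q] has smaller degree and value [q], so its dominant exponent is 0 and it cannot disturb
    the term of exponent [d > 0]: [taylor R] keeps a term of value [q] there for the weight [e]. For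
    [e'] the same term is at least [r > q], hence [e' > e]. *)
Lemma gauss_key_lt Q R q r e d e' d' :
  Q \is monic -> R \is monic -> size Q = size R ->
  gauss_key e d Q q -> gauss_key e' d' R r ->
  ltE (Some q) (Some r) -> ltE (Some e) (Some e').
Proof.
have rv := poly_valuation_ring.
move=> Qmon Rmon szQR [d0 nuQ domQ smallQ] [_ nuR domR _] qr.
have RE : R = Q + (R - Q) by rewrite addrC subrK.
have szRQ : (size (R - Q)%R < size Q)%N.
  rewrite -[size Q]prednK ?size_poly_gt0 ?monic_neq0 // ltnS.
  apply/leq_sizeP => j; rewrite leq_eqVlt => /orP[/eqP <-|Qj].
    by rewrite coefB {1}szQR -!/(lead_coef _) (monicP Qmon) (monicP Rmon) subrr.
  rewrite coefB !nth_default ?subr0 -?szQR //; move: Qj;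
  by rewrite prednK // size_poly_gt0 monic_neq0.
have nuRQ : nu (R - Q) = Some q.
  rewrite addrC; apply: val_addl => //; last by rewrite nuR.
  by rewrite valN.
have RQ0 : R - Q != 0 by apply: contraTneq (isT) => RQ; move: nuRQ; rewrite RQ; case: rv => ->.
have [c nuc domRQ] := smallQ _ RQ0 szRQ.
move: nuc domRQ; rewrite nuRQ => -[<-] [_ _ RQlt].
case: domQ => Qd _ _; case: domR => _ Rle _.
have Rd : gterm nu e (taylor R) d = Some q.
  rewrite RE taylorD /gterm coefD; move: Qd (RQlt d d0); rewrite /gterm.
  case Qd: (nu (taylor Q)`_d) => [b|] //= [<-]; rewrite ltE_subr addrK => ltb.
  by rewrite (val_addl rv Qd).
move: Rd (Rle d); rewrite /gterm; case: (nu _) => [b|] //= [qE] rle.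
have := ltE_le_trans qr (rle : leE (Some r) (Some _)).
by rewrite -qE !ltEN /= leL_add2l leL_pmuln.
Qed.

End KeyPolynomials.

(** * Uniqueness of the extension *)

Section GaussMore.
Variables (L : divOrdGroup) (A : comNzRingType) (nu : A -> option L).
Hypothesis nuP : ring_valuation nu.
Implicit Types (e c : L) (p q : {poly A}).

Lemma gauss_dom_le e e' p c d c' d' : leL e e' ->
  gauss_dom nu e p c d -> gauss_dom nu e' p c' d' -> leL c c'.
Proof.
move=> ee' [_ lep _] [pd' _ _]; have := lep d'; rewrite -/(leE (Some c) (Some c')) -pd'.
move/leE_trans; apply; rewrite /gterm leED ?leExx //=; exact: leL_muln.
Qed.

Lemma gauss_dom_lt e e' p c d c' d' : ltE (Some e) (Some e') ->
  ltE (Some c') (nu p`_0) ->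
  gauss_dom nu e p c d -> gauss_dom nu e' p c' d' -> ltE (Some c) (Some c').
Proof.
move=> ee' c'p [_ lep _] [pd' _ _]; have := lep d'; rewrite -pd'.
move/leE_lt_trans; apply; case: d' pd' => [|d'].
  by rewrite /gterm mulr0n addE0 => p0; move: c'p; rewrite p0 ltE_irr.
rewrite /gterm; case: (nu _) => // a _.
by rewrite !ltEN /= leL_add2l leL_pmuln //; rewrite ltEN in ee'.
Qed.

Lemma gauss_domC e a c : nu a = Some c -> gauss_dom nu e a%:P c 0.
Proof.
have [nu0 _ _ _] := nuP.
move=> ac; split=> [|s|s s0]; rewrite /gterm coefC.
- by rewrite ac mulr0n addE0.
- by case: s => [|s]; rewrite ?ac ?nu0 //= mulr0n addr0 leLL.
- by rewrite gtn_eqF // nu0.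
Qed.

Lemma gauss_domX e p c d k :
  gauss_dom nu e p c d -> gauss_dom nu e (p ^+ k) (c *+ k) (d * k).
Proof.
move=> pd; elim: k => [|k IH]; first by rewrite muln0; apply: gauss_domC; have [] := nuP.
by rewrite exprS mulrS mulnS; apply: gauss_domM.
Qed.

Lemma gauss_dom_sum_lt e (I : Type) (r : seq I) (P : pred I) (F : I -> {poly A}) c s :
  (forall j, P j -> ltE (Some c) (gterm nu e (F j) s)) ->
  ltE (Some c) (gterm nu e (\sum_(j <- r | P j) F j) s).
Proof.
move=> FP; rewrite /gterm ltE_subr coef_sum; apply: val_sum_lt => // j Pj.
by rewrite -ltE_subr; apply: FP.
Qed.

End GaussMore.

Section LimitValue.
Variables (K : fieldType) (L : divOrdGroup) (v : K -> option L).
Variable nu : {poly K} -> option L.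
Hypotheses (vP : is_valuation v) (nuP : is_poly_valuation v nu).

Let nur : ring_valuation nu := poly_valuation_ring nuP.
Let nuM f g : nu (f * g) = addE (nu f) (nu g). Proof. by have [] := nur. Qed.

Lemma taylorX (p : {poly K}) k : taylor (p ^+ k) = taylor p ^+ k.
Proof. by elim: k => [|k IH]; rewrite ?taylor1 // !exprS taylorM IH. Qed.

Lemma taylorC (a : K) : taylor a%:P = a%:P%:P.
Proof. by rewrite /taylor map_polyC comp_polyC. Qed.

Lemma taylor_sum (I : Type) (r : seq I) (P : pred I) (F : I -> {poly K}) :
  taylor (\sum_(j <- r | P j) F j) = \sum_(j <- r | P j) taylor (F j).
Proof. exact: (big_morph _ (@taylorD K) (@taylor0 K)). Qed.

(** Where the truncation agrees with [nu] on [g], it agrees with [nu] on each term of [h \Po g], so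
    strict dominance persists. The value [k] does not involve [e], hence [h \Po g] is stable
    wherever [g] is. *)
Lemma comp_poly_dom e (h g : {poly K}) l d j0 k :
  gauss_dom nu e (taylor g) l d -> nu g = Some l -> (j0 < size h)%N ->
  nu ((h`_j0)%:P * g ^+ j0) = Some k ->
  (forall j, (j < size h)%N -> j != j0 -> ltE (Some k) (nu ((h`_j)%:P * g ^+ j))) ->
  exists d', gauss_dom nu e (taylor (h \Po g)) k d'.
Proof.
move=> gd gl j0h hj0 hj.
have term j c : nu ((h`_j)%:P * g ^+ j) = Some c ->
    gauss_dom nu e (taylor ((h`_j)%:P * g ^+ j)) c (d * j).
  rewrite nuM (valX nur j gl) (nuC nuP); case hjE: (v h`_j) => [a|] //= [<-].
  rewrite taylorM taylorX taylorC -[(d * j)%N]add0n.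
  by apply: gauss_domM => //; [apply: gauss_domC; rewrite ?(nuC nuP) | apply: gauss_domX].
have rest j s : (j < size h)%N -> j != j0 ->
    ltE (Some k) (gterm nu e (taylor ((h`_j)%:P * g ^+ j)) s).
  move=> jh jj0; case nuj: (nu ((h`_j)%:P * g ^+ j)) (hj j jh jj0) => [c|] kc.
    by have [_ le_c _] := term _ _ nuj; apply: ltE_le_trans kc (le_c s).
  have -> : (h`_j)%:P * g ^+ j = 0.
    move: nuj; rewrite nuM (valX nur j gl) (nuC nuP).
    by case hjE: (v h`_j) => [a|] //; case: vP => /(_ h`_j)[/(_ hjE) -> _ _ _]; rewrite mul0r.
  by rewrite taylor0 /gterm coef0; have [-> _ _ _] := nur.
exists (d * j0)%N; rewrite comp_polyE taylor_sum (bigD1 (Ordinal j0h)) //=.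
rewrite -mul_polyC; apply: gauss_dom_add => // [|s|s _]; first exact: term.
  apply/ltEW/gauss_dom_sum_lt => // j jj0; rewrite -mul_polyC.
  exact: rest.
apply/gauss_dom_sum_lt => // j jj0; rewrite -mul_polyC; exact: rest.
Qed.

Variable E : L -> Prop.
Hypothesis E_nomax : forall e, E e -> exists2 e', E e' & ltE (Some e) (Some e').
Hypothesis E_dom : forall e, E e -> forall p : {poly K}, p != 0 ->
  exists c d, gauss_dom nu e (taylor p) c d.

(** Only constancy of the truncated value is recorded, without reference to [nu g]: constancy is
    what fails for multiples of [f]. *)
Definition stable_at (g : {poly K}) (l : L) (e0 : L) : Prop :=
  forall e, E e -> leL e0 e -> exists d, gauss_dom nu e (taylor g) l d.

(** Asked at every level rather than cofinally: this makes the truncated value of [f] grow strictly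
    between any two levels. *)
Definition unstable (f : {poly K}) : Prop :=
  forall e c d, E e -> gauss_dom nu e (taylor f) c d -> ltE (Some c) (nu f).

(** Between two levels the truncated value of [q] does not decrease and that of [f] strictly
    increases, so their sum is not constant. *)
Lemma multiple_not_stable (f q : {poly K}) k e0 :
  unstable f -> E e0 -> ~ stable_at (q * f) k e0.
Proof.
move=> uf Ee0 st; have [e1 Ee1 e01] := E_nomax Ee0.
have [d0 dom0] := st e0 Ee0 (leLL e0); have [d1 dom1] := st e1 Ee1 (ltEW e01).
have qf0 : q * f != 0.
  apply: contraPneq dom0 => ->; rewrite taylor0 => -[].
  by rewrite /gterm coef0; have [-> _ _ _] := nur.
have q0 : q != 0 by apply: contraNneq qf0 => ->; rewrite mul0r.
have f0 : f != 0 by apply: contraNneq qf0 => ->; rewrite mulr0.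
have [a0 [b0 q_dom0]] := E_dom Ee0 q0; have [a1 [b1 q_dom1]] := E_dom Ee1 q0.
have [c0 [g0 f_dom0]] := E_dom Ee0 f0; have [c1 [g1 f_dom1]] := E_dom Ee1 f0.
have lea := gauss_dom_le (ltEW e01) q_dom0 q_dom1.
have ltc : ltE (Some c0) (Some c1).
  apply: (gauss_dom_lt e01 _ f_dom0 f_dom1); rewrite coef_taylor /hasse nderivn0.
  exact: uf f_dom1.
rewrite taylorM in dom0 dom1.
have [k0 _] := gauss_dom_uniq (gauss_domM nur q_dom0 f_dom0) dom0.
have [k1 _] := gauss_dom_uniq (gauss_domM nur q_dom1 f_dom1) dom1.
have := leE_ltD (lea : leE (Some a0) (Some a1)) ltc.
by rewrite /= k0 k1 ltE_irr.
Qed.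

(* [h] is a polynomial over [K] all of whose roots have value [r], given by its
   Newton polygon. *)
Lemma single_slope_value (f g h : {poly K}) n l r e0 :
  unstable f -> E e0 -> stable_at g l e0 -> nu g = Some l ->
  h \is monic -> size h = n.+1 -> v h`_0 = Some (r *+ n) ->
  (forall j, leE (Some (r *+ n)) (addE (v h`_j) (Some (r *+ j)))) ->
  f %| h \Po g -> l = r.
Proof.
move=> uf Ee0 st gl hmon szh h0 hj /dvdpP[q hq].
have not_dom j0 k : (j0 < size h)%N -> nu ((h`_j0)%:P * g ^+ j0) = Some k ->
    (forall j, (j < size h)%N -> j != j0 -> ltE (Some k) (nu ((h`_j)%:P * g ^+ j))) -> False.
  move=> j0h hj0 dom; apply: (@multiple_not_stable f q k e0) => // e Ee e0e.
  have [d gd] := st e Ee e0e; rewrite -hq; exact: comp_poly_dom gd gl j0h hj0 dom.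
have nuj j : nu ((h`_j)%:P * g ^+ j) = addE (v h`_j) (Some (l *+ j)).
  by rewrite nuM (nuC nuP) (valX nur j gl).
(* For [l > r] the constant term of [h \Po g] strictly dominates, for [l < r] the leading one. *)
apply/eqP/negP => /negP lr; case/orP: (leL_total r l) => [rl|lr'].
  apply: (@not_dom 0 (r *+ n)); rewrite ?szh //; first by rewrite nuj h0 mulr0n addE0.
  move=> [|j] // _ _; rewrite nuj; have := hj j.+1.
  have rl' : ltE (Some r) (Some l) by rewrite /ltE /= rl andbT eq_sym.
  case: (v _) => // a /leE_lt_trans; apply; rewrite ltEN /= leL_add2l leL_pmuln //.
  by rewrite ltEN in rl'.
have lr'' : ltE (Some l) (Some r) by rewrite /ltE /= lr' andbT.
apply: (@not_dom n (l *+ n)); rewrite ?szh //.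
  have -> : h`_n = 1 by rewrite -[n]/(n.+1.-1) -szh -lead_coefE (monicP hmon).
  by rewrite nuM (valX nur n gl); have [_ -> _ _] := nur; rewrite add0E.
move=> j jn jn'; rewrite nuj; have := hj j.
have {jn jn'} ltjn : (j < n)%N by rewrite ltn_neqAle jn' -ltnS.
rewrite -(subnKC (ltnW ltjn)) !mulrnDr leE_subr ltE_subr ![_ *+ j + _]addrC !addrK.
move/(ltE_le_trans _); apply; rewrite ltL_pmuln ?subn_gt0 //.
Qed.

End LimitValue.

Section UniqueExtension.
Variables (K W : fieldType) (L : divOrdGroup) (i : {rmorphism K -> W}).
Variables (v : K -> option L) (w : W -> option L) (nu : {poly K} -> option L).
Hypotheses (vP : is_valuation v) (wP : is_valuation w) (nuP : is_poly_valuation v nu).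
Hypotheses (wi : forall c, w (i c) = v c) (hens : henselian v).
Variables (n : nat) (t : 'I_n -> W) (f : {poly K}).
Hypothesis fE : map_poly i f = \prod_(k < n) ('X - (t k)%:P).
Hypothesis f_irr : irreducible_poly f.
Variable E : L -> Prop.
Hypothesis E_nomax : forall e, E e -> exists2 e', E e' & ltE (Some e) (Some e').
Hypothesis E_dom : forall e, E e -> forall p : {poly K}, p != 0 ->
  exists c d, gauss_dom nu e (taylor p) c d.
Hypothesis f_unst : unstable nu E f.

Let wr := valuation_ring wP.

Lemma root_neq0 (g : {poly K}) k : g != 0 -> (size g < size f)%N ->
  (map_poly i g).[t k] != 0.
Proof.
move=> g0 gf; have cop : coprimep f g.
  have [_ irr] := f_irr; rewrite /coprimep; apply/negPn/negP => sz1.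
  have /eqp_size := irr _ sz1 (dvdp_gcdl f g).
  have := dvdp_leq g0 (dvdp_gcdr f g) => le_g szE.
  by move: (leq_ltn_trans le_g gf); rewrite szE ltnn.
have := cop; rewrite -(coprimep_map i) => /coprimep_root; apply.
by rewrite fE rootE horner_prod; apply/prodf_eq0; exists k; rewrite // hornerXsubC subrr.
Qed.

(** The polynomial with roots [g (t j)] descends to [K] as [h] by symmetry, and its roots share one
    value by [conjugate_values]. Factor by factor, ['X - t j] divides [g - g (t j)], so [f] divides
    [h \Po g] and [single_slope_value] applies. *)
Lemma value_at_root (g : {poly K}) l e0 k : g != 0 -> (size g < size f)%N ->
  nu g = Some l -> E e0 -> stable_at nu E g l e0 ->
  w (map_poly i g).[t k] = Some l.
Proof.
move=> g0 gf gl Ee0 st.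
pose x k := (map_poly i g).[t k].
have x0 j : x j != 0 by apply: root_neq0.
have [r wx] : exists r, forall j, w (x j) = Some r.
  case wk: (w (x k)) => [r|]; last first.
    by move/eqP: wk; rewrite (valuation_eq0 wP) (negPf (x0 k)).
  exists r => j; rewrite -wk.
  exact: (conjugate_values vP wP wi hens fE f_irr x0).
suff -> : l = r by exact: wx.
have [h hE] : exists h, \prod_(j < n) ('X - (x j)%:P) = map_poly i h.
  have [|h hE] := symmetric_poly_eval fE (p := \prod_(j < n) ('X - (mpoly_at g j)%:P)).
    move=> s; rewrite rmorph_prod /= [RHS](reindex_inj (@perm_inj _ s)) /=.
    apply: eq_bigr => j _.
    by rewrite rmorphB /= map_polyX map_polyC /= msym_mpoly_at.
  exists h; rewrite -hE rmorph_prod /=; apply: eq_bigr => j _.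
  by rewrite rmorphB /= map_polyX map_polyC /= mmap_mpoly_at.
have dom_x j : gauss_dom w r ('X - (x j)%:P) r 1.
  have [w0 w1 _ _] := wr.
  split=> [|s|s s1]; rewrite /gterm coefB coefX coefC /=.
  - by rewrite subr0 w1 add0E.
  - case: s => [|[|s]] /=; rewrite ?sub0r ?subr0 ?(valN wr) ?wx ?w1 ?w0 //=.
      by rewrite mulr0n addr0 leLL.
    by rewrite add0r leLL.
  - by case: s s1 => [|[|s]] //= _; rewrite subr0 w0.
have dom_h : gauss_dom w r (map_poly i h) (r *+ n) n.
  have dom_s (s : seq 'I_n) :
      gauss_dom w r (\prod_(j <- s) ('X - (x j)%:P)) (r *+ size s) (size s).
    elim: s => [|j s IH]; first by rewrite big_nil; apply: gauss_domC; have [] := wr.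
    by rewrite big_cons /= mulrS -add1n; apply: gauss_domM.
  by have := dom_s (enum 'I_n); rewrite big_enum -cardE card_ord hE.
apply: (single_slope_value vP nuP E_nomax E_dom f_unst Ee0 st gl (h := h) (n := n)).
- by rewrite -(map_monic i) -hE; apply: monic_prod => j _; apply: monicXsubC.
- by rewrite -(size_map_poly i) -hE (eq_bigl (mem 'I_n)) // -big_enum size_prod_XsubC -cardE card_ord.
- rewrite -wi -coef_map -hE -horner_coef0 horner_prod (val_prod wr).
  rewrite (eq_bigr (fun=> Some r)) => [|j _]; last first.
    by rewrite hornerXsubC sub0r (valN wr) wx.
  rewrite big_const card_ord; elim: (n) => [|m IH] //=.
  by rewrite IH /= mulrS.
- by move=> j; have [_ + _] := dom_h => /(_ j); rewrite /gterm coef_map /= wi.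
- rewrite -(dvdp_map i) fE map_comp_poly -hE rmorph_prod /=.
  apply: (big_ind2 (fun p q : {poly W} => p %| q)) => // [a b c d|j _].
    exact: dvdp_mul.
  by rewrite comp_polyB comp_polyX comp_polyC dvdp_XsubCl rootE !hornerE subrr.
Qed.

End UniqueExtension.

(** * Truncations *)

Section MinFold.
Variable L : divOrdGroup.

Lemma foldr_minE_le (F : nat -> option L) (r : seq nat) j : j \in r ->
  leE (foldr (@minE L) None [seq F s | s <- r]) (F j).
Proof.
elim: r => //= k r IH; rewrite inE => jr.
set M := foldr _ _ _ in IH *; have := leExx (minE (F k) M).
by rewrite leE_minP => /andP[MF MM]; case/orP: jr => [/eqP-> //|/IH]; apply: leE_trans.
Qed.

Lemma foldr_minE_attained (F : nat -> option L) (r : seq nat) :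
  foldr (@minE L) None [seq F s | s <- r] = None \/
  exists2 j, j \in r & foldr (@minE L) None [seq F s | s <- r] = F j.
Proof.
elim: r => [|j r IH] /=; first by left.
move: IH; set M := foldr _ _ _ => IH; rewrite /minE.
case: ifP => _; first by right; exists j; rewrite ?mem_head.
by case: IH => [->|[k kr ->]]; [left | right; exists k; rewrite ?inE ?kr ?orbT].
Qed.

End MinFold.

Section Expansion.
Variable K : fieldType.
Implicit Types f Q : {poly K}.

Lemma size_hasse s f : (size (hasse s f) <= size f - s)%N.
Proof.
apply/leq_sizeP => j; rewrite leq_subLR => fj.
by rewrite coef_nderivn nth_default ?mul0rn.
Qed.

Lemma Q_expansion_rest Q f n :
  f = \sum_(i < n) qcoef Q f i * Q ^+ i + f %/ Q ^+ n * Q ^+ n.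
Proof.
elim: n => [|n IH]; first by rewrite big_ord0 expr0 divp1 mulr1 add0r.
rewrite {1}IH big_ord_recr /= -addrA; congr (_ + _).
rewrite {1}(divp_eq (f %/ Q ^+ n) Q) divp_divl -exprSr mulrDl addrC.
by rewrite -mulrA -exprS.
Qed.

Lemma Q_expansion Q f : (1 < size Q)%N ->
  f = \sum_(i < size f) qcoef Q f i * Q ^+ i.
Proof.
move=> Q1; rewrite {1}(Q_expansion_rest Q f (size f)) divp_small ?mul0r ?addr0 //.
have Q0 : Q != 0 by rewrite -size_poly_gt0 ltnW.
have := size_exp Q (size f); case: (size (Q ^+ _)) (size_poly_eq0 (Q ^+ size f)) => [|k _ /= ->].
  by rewrite expf_eq0 (negPf Q0) andbF.
by rewrite ltnS leq_pmull // -ltnS prednK // ltnW.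
Qed.

Lemma size_qcoef Q f i : Q != 0 -> (size (qcoef Q f i) < size Q)%N.
Proof. by move=> Q0; rewrite /qcoef ltn_modp. Qed.

Lemma qcoef_degree Q f i : Q != 0 -> qcoef Q f i != 0 -> (i * (size Q).-1 <= (size f).-1)%N.
Proof.
move=> Q0 c0; have : f %/ Q ^+ i != 0.
  by apply: contraNneq c0 => c0; rewrite /qcoef c0 mod0p.
rewrite divpN0 ?expf_neq0 // => /(leq_sub2r 1); rewrite !subn1 size_exp.
by rewrite mulnC.
Qed.

End Expansion.

Section Truncation.
Variables (K : fieldType) (L : divOrdGroup) (v : K -> option L).
Variable nu : {poly K} -> option L.
Hypothesis nuP : is_poly_valuation v nu.
Variables (Q : {poly K}) (q e : L) (d : nat).
Hypotheses (Q1 : (1 < size Q)%N) (keyQ : gauss_key nu e d Q q).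

Let nur : ring_valuation nu := poly_valuation_ring nuP.

(* The truncation [nu_Q] is the Gauss valuation of weight [e] of the Taylor
   expansion, since the terms of the [Q]-expansion have distinct Gauss degrees. *)
Lemma nuQ_gauss f : f != 0 ->
  exists2 k, nuQ nu Q f = Some k & gauss_dom nu e (taylor f) k (d * degQ nu Q f) /\
    (degQ nu Q f * (size Q).-1 <= (size f).-1)%N.
Proof.
have [d0 nuQq domQ smallQ] := keyQ; have [nu0 nu1 nuM _] := nur.
have Q0 : Q != 0 by rewrite -size_poly_gt0 ltnW.
move=> f0; pose F i := nu (qcoef Q f i * Q ^+ i).
have Fdom i : qcoef Q f i != 0 ->
    exists2 c, F i = Some c & gauss_dom nu e (taylor (qcoef Q f i * Q ^+ i)) c (d * i).
  move=> c0; have [c cE c_dom] := smallQ _ c0 (size_qcoef f i Q0).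
  exists (c + q *+ i); first by rewrite /F nuM cE (valX nur i nuQq).
  rewrite taylorM taylorX -[(d * i)%N]add0n.
  by apply: gauss_domM => //; apply: gauss_domX.
have nuQE : nuQ nu Q f = foldr (@minE L) None [seq F i | i <- iota 0 (size f)] by [].
have [k nuQk] : exists k, nuQ nu Q f = Some k.
  case nuQk: (nuQ nu Q f) => [k|]; first by exists k.
  have [i ci0] : exists i : 'I_(size f), qcoef Q f i != 0.
    apply/existsP; apply: contraNT f0; rewrite negb_exists => /forallP all0.
    rewrite (Q_expansion f Q1) big1 // => i _.
    by have := all0 i; rewrite negbK => /eqP->; rewrite mul0r.
  have := @foldr_minE_le _ F (iota 0 (size f)) i; rewrite mem_iota ltn_ord => /(_ isT).
  by have [c -> _] := Fdom i ci0; rewrite -nuQE nuQk.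
have Fge i : (i < size f)%N -> leE (Some k) (F i).
  by move=> fi; rewrite -nuQk nuQE; apply: foldr_minE_le; rewrite mem_iota.
have [i0 i0f Fi0] : exists2 i0, (i0 < size f)%N & F i0 = Some k.
  have := foldr_minE_attained F (iota 0 (size f)); rewrite -nuQE nuQk.
  by case=> // -[i]; rewrite mem_iota => fi Fi; exists i.
pose P (i : 'I_(size f)) := F i == nuQ nu Q f.
have Pi0 : P (Ordinal i0f) by rewrite /P /= Fi0 nuQk.
have [I PI Imax] := arg_maxnP (fun i : 'I_(size f) => i : nat) Pi0.
have degE : degQ nu Q f = I.
  apply/eqP; rewrite eqn_leq; apply/andP; split.
    by apply/bigmax_leqP => i Pi; apply: Imax.
  exact: (leq_bigmax_cond (F := fun i : 'I_(size f) => i : nat) I PI).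
have FI : F I = Some k by move/eqP: PI; rewrite nuQk.
have cI0 : qcoef Q f I != 0.
  by apply: contra_eq_neq FI => cI; rewrite /F cI mul0r nu0.
exists k => //; rewrite degE; split; last exact: qcoef_degree.
have rest (i : 'I_(size f)) s : i != I ->
    leE (Some k) (gterm nu e (taylor (qcoef Q f i * Q ^+ i)) s) /\
    ((d * I <= s)%N -> ltE (Some k) (gterm nu e (taylor (qcoef Q f i * Q ^+ i)) s)).
  move=> iI; have [ci|ci0] := eqVneq (qcoef Q f i) 0.
    by rewrite ci mul0r taylor0 /gterm coef0 nu0.
  have [c Fi [_ le_c lt_c]] := Fdom i ci0.
  have kc : leE (Some k) (Some c) by rewrite -Fi; apply: Fge.
  split=> [|Is]; first exact: leE_trans kc (le_c s).
  (* A tie in value forces [i < I] by the choice of [I], and then [d * i < d * I] because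
     [d > 0]. *)
  have [ck|kc'] := eqVneq c k; last first.
    apply: ltE_le_trans (le_c s); rewrite /ltE kc andbT.
    by apply: contra kc' => /eqP[->].
  rewrite -ck; apply: lt_c; apply: leq_trans Is; rewrite ltn_pmul2l //.
  rewrite ltn_neqAle iI /=; apply: Imax; by rewrite /P Fi nuQk ck.
have -> : taylor f = \sum_(i < size f) taylor (qcoef Q f i * Q ^+ i).
  by rewrite {1}(Q_expansion f Q1) taylor_sum.
rewrite (bigD1 I) //=.
have [c FIc cdom] := Fdom I cI0; have kc : c = k by move: FIc; rewrite FI => -[].
rewrite -{1}kc; apply: gauss_dom_add => // [s|s Is]; rewrite kc.
  rewrite /gterm leE_subr coef_sum; apply: (val_sum_le nur) => i iI.
  by rewrite -leE_subr; have [] := rest i s iI.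
by apply: gauss_dom_sum_lt => // i iI; have [_] := rest i s iI; apply.
Qed.

End Truncation.

Section RootCounting.
Variables (W : fieldType) (L : divOrdGroup) (w : W -> option L).
Hypothesis wP : is_valuation w.
Variable e : L.

Let wr := valuation_ring wP.

(** By multiplicativity one linear factor suffices: for ['X - a] the dominant exponent is 1 if
    [w a >= e] and 0 otherwise, that is, the boolean read as a number. *)
Lemma gauss_dom_roots (s : seq W) :
  exists c, gauss_dom w e (\prod_(a <- s) ('X - a%:P)) c (count (fun a => leE (Some e) (w a)) s).
Proof.
have [w0 w1 _ _] := wr.
elim: s => [|a s [c IH]]; first by rewrite big_nil; exists 0; apply: gauss_domC.
suff [c' dom] : exists c', gauss_dom w e ('X - a%:P) c' (leE (Some e) (w a)).
  by exists (c' + c); rewrite big_cons /=; apply: gauss_domM.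
have g0 : gterm w e ('X - a%:P) 0 = w a.
  by rewrite /gterm coefB coefX coefC sub0r (valN wr) mulr0n addE0.
have g1 : gterm w e ('X - a%:P) 1 = Some e.
  by rewrite /gterm coefB coefX coefC subr0 w1 add0E.
have g2 s' : gterm w e ('X - a%:P) s'.+2 = None.
  by rewrite /gterm coefB coefX coefC subr0 w0.
case ea: (leE (Some e) (w a)); last move/leEP: ea => ae.
  exists e; split=> // [[|[|s']]|[|[|s']]] //; rewrite ?g0 ?g1 ?g2 //; exact: leExx.
case wa: (w a) ae => [c'|] // ae; exists c'; rewrite wa in g0.
split=> // [[|[|s']]|[|[|s']]] //; rewrite ?g0 ?g1 ?g2 //; first exact: leExx.
exact: ltEW.
Qed.

End RootCounting.

(** * Counting roots *)

(** The bridge from Hasse derivatives to distances: the roots of the shifted polynomial are the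
    differences between the roots of [p] and [a]. *)
Lemma map_taylor (K W : fieldType) (i : {rmorphism K -> W}) (a : W) (p : {poly K}) :
  map_poly (horner_eval a \o map_poly i) (taylor p) = map_poly i p \Po ('X + a%:P).
Proof.
rewrite /taylor map_comp_poly rmorphD /= map_polyX map_polyC /= horner_evalE map_polyX hornerX.
congr (_ \Po _); rewrite -map_poly_comp; apply: eq_map_poly => c /=.
by rewrite horner_evalE map_polyC hornerC.
Qed.

Lemma split_monic_factor (W : fieldType) (p : {poly W}) (rs : seq W) :
  p \is monic -> p %| \prod_(r <- rs) ('X - r%:P) ->
  exists ts, p = \prod_(r <- ts) ('X - r%:P).
Proof.
move=> pmon /dvdp_prod_XsubC[m]; rewrite eqp_monic ?monic_prod_XsubC // => /eqP->.
by exists (mask m rs).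
Qed.

Lemma prod_XsubC_shift (W : fieldType) (s : seq W) (x : W) :
  \prod_(y <- s) ('X - (y - x)%:P) = (\prod_(y <- s) ('X - y%:P)) \Po ('X + x%:P).
Proof.
rewrite rmorph_prod /=; apply: eq_bigr => y _.
by rewrite comp_polyB comp_polyX comp_polyC polyCB opprB addrA.
Qed.

Section DegreeBound.
Variables (K : fieldType) (L : divOrdGroup) (v : K -> option L).
Variable nu : {poly K} -> option L.
Hypotheses (vP : is_valuation v) (nuP : is_poly_valuation v nu) (hens : henselian v).
Variables (f Q : {poly K}) (E : L -> Prop).
Hypotheses (f_irr : irreducible_poly f) (f_monic : f \is monic) (Q_monic : Q \is monic).
Hypothesis Qf : (size Q < size f)%N.
Hypothesis E_nomax : forall e, E e -> exists2 e', E e' & ltE (Some e) (Some e').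
Hypothesis E_dom : forall e, E e -> forall p : {poly K}, p != 0 ->
  exists c d, gauss_dom nu e (taylor p) c d.
Hypothesis f_unst : unstable nu E f.
Hypothesis f_min : forall g : {poly K}, g != 0 -> (size g < size f)%N ->
  exists l e0, [/\ nu g = Some l, E e0 & stable_at nu E g l e0].

(* Count in two ways the pairs of a root [x] of [f] and a root [y] of [Q] with
   [w (y - x) >= e]: each [x] occurs [d] times, each [y] at most [D] times. *)
Lemma degree_bound e q d k D : E e ->
  gauss_dom nu e (taylor Q) q d -> gauss_dom nu e (taylor f) k D ->
  ((size f).-1 * d <= (size Q).-1 * D)%N.
Proof.
move=> Ee domQ domf; have [nu0 _ _ _] := poly_valuation_ring nuP.
have fQ0 : f * Q != 0 by rewrite mulf_neq0 ?monic_neq0.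
have [W [i [alg [rs rsE]]]] := splitting_field_exists fQ0.
have lead1 : lead_coef (f * Q) = 1 by rewrite lead_coefM (monicP f_monic) (monicP Q_monic) mulr1.
rewrite lead1 rmorph1 scale1r rmorphM /= in rsE.
have [ts tsE] : exists ts, map_poly i f = \prod_(r <- ts) ('X - r%:P).
  by apply: (@split_monic_factor _ _ rs); rewrite ?map_monic // -rsE dvdp_mulr.
have [os osE] : exists os, map_poly i Q = \prod_(r <- os) ('X - r%:P).
  by apply: (@split_monic_factor _ _ rs); rewrite ?map_monic // -rsE dvdp_mull.
have szts : (size f).-1 = size ts by rewrite -(size_map_poly i) tsE size_prod_XsubC.
have szos : (size Q).-1 = size os by rewrite -(size_map_poly i) osE size_prod_XsubC.
have [w wP wi] := valuation_extension vP alg.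
have [w0 _ _ _] := valuation_ring wP.
have fE : map_poly i f = \prod_(j < size ts) ('X - (tnth (in_tuple ts) j)%:P).
  by rewrite tsE big_tnth.
have value (x : W) (g : {poly K}) : x \in ts -> (size g < size f)%N ->
    w (map_poly i g).[x] = nu g.
  move=> xts gf; have /tnthP[j ->] : x \in in_tuple ts by [].
  have [->|g0] := eqVneq g 0; first by rewrite rmorph0 horner0 w0.
  have [l [e0 [gl Ee0 st]]] := f_min g0 gf.
  rewrite gl.
  exact: (value_at_root vP wP nuP wi hens fE f_irr E_nomax E_dom f_unst j g0 gf gl Ee0 st).
pose near y x := leE (Some e) (w (y - x)).
have locQ x : x \in ts -> count (near^~ x) os = d.
  move=> xts; have dom : gauss_dom w e (map_poly i Q \Po ('X + x%:P)) q d.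
    have gE s : gterm w e (map_poly i Q \Po ('X + x%:P)) s = gterm nu e (taylor Q) s.
      rewrite -map_taylor /gterm coef_map /= horner_evalE coef_taylor value //.
      by apply: leq_ltn_trans Qf; apply: leq_trans (size_hasse _ _) (leq_subr _ _).
    by case: domQ => Qd le_q lt_q; split=> [|s|s ds]; rewrite gE; [|exact: le_q|exact: lt_q].
  have [c] := gauss_dom_roots wP e [seq y - x | y <- os].
  rewrite big_map count_map prod_XsubC_shift -osE.
  by move=> dom'; have [_ ->] := gauss_dom_uniq dom dom'.
have locf x : x \in ts -> count (near^~ x) ts = D.
  move=> xts; have dom : gauss_dom w e (map_poly i f \Po ('X + x%:P)) k D.
    have gE s : (0 < s)%N ->
        gterm w e (map_poly i f \Po ('X + x%:P)) s = gterm nu e (taylor f) s.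
      move=> s0; rewrite -map_taylor /gterm coef_map /= horner_evalE coef_taylor value //.
      apply: leq_ltn_trans (size_hasse _ _) _; rewrite ltn_subrL s0 size_poly_gt0.
      exact: monic_neq0.
    have g0 : gterm w e (map_poly i f \Po ('X + x%:P)) 0 = None.
      rewrite -map_taylor /gterm coef_map /= horner_evalE coef_taylor /hasse nderivn0.
      suff /rootP-> : root (map_poly i f) x by rewrite w0.
      by rewrite tsE root_prod_XsubC.
    (* [D = 0] would give [k = nu f]; so the dominant term is not the constant one, which is lost at
       the root [x]. *)
    have kf := f_unst Ee domf.
    case: domf => fD le_k lt_k; split=> [|s|s Ds].
    - rewrite gE // lt0n; apply: contraTneq kf => D0; move: fD; rewrite D0.
      by rewrite /gterm coef_taylor /hasse nderivn0 mulr0n addE0 => ->; rewrite ltE_irr.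
    - by case: s => [|s]; rewrite ?g0 // gE.
    - by rewrite gE ?(leq_ltn_trans _ Ds) //; apply: lt_k.
  have [c] := gauss_dom_roots wP e [seq y - x | y <- ts].
  rewrite big_map count_map prod_XsubC_shift -tsE.
  by move=> dom'; have [_ ->] := gauss_dom_uniq dom dom'.
(* By the ultrametric inequality, if some root [x] of [f] is near [y], then all roots of [f] near
   [y] are near [x], and there are [D] of the latter. *)
have nearD y : (count (near y) ts <= D)%N.
  have [/hasP[x xts yx]|] := boolP (has (near y) ts); last first.
    by rewrite has_count -eqn0Ngt => /eqP->.
  rewrite -(locf x xts); apply: sub_count => x' /= yx'.
  rewrite /near -(subrKA y) addrC; apply: (val_leD (valuation_ring wP)) => //.
  by rewrite -(valN (valuation_ring wP)) opprB.
have double : (\sum_(x <- ts) count (near^~ x) os = \sum_(y <- os) count (near y) ts)%N.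
  under eq_bigr do rewrite -sum1_count big_mkcond.
  by rewrite exchange_big /=; apply: eq_bigr => y _; rewrite -big_mkcond sum1_count.
have lhs : (\sum_(x <- ts) count (near^~ x) os = size ts * d)%N.
  rewrite big_seq (eq_bigr (fun=> d)) => [|x /locQ //].
  by rewrite -big_seq big_const_seq count_predT iter_addn_0 mulnC.
rewrite szts szos -lhs double; elim: (os) => [|y s IH]; first by rewrite big_nil.
by rewrite big_cons mulSn leq_add.
Qed.

End DegreeBound.

(** * Limit key polynomials *)

Section LimitKeyPolynomials.
Variables (K : fieldType) (L : divOrdGroup) (v : K -> option L).
Variables (nu : {poly K} -> option L) (m : nat) (QQ : {poly K} -> Prop).
Hypotheses (vP : is_valuation v) (nuP : is_poly_valuation v nu) (m_gt0 : (0 < m)%N).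
Hypothesis Psi_nomax :
  forall P, Psi nu m P -> exists2 P', Psi nu m P' & ltE (nu P) (nu P').
Hypothesis QQ_good : good_family nu m QQ.

Let nur : ring_valuation nu := poly_valuation_ring nuP.

Let QQ_Psi Q : QQ Q -> Psi nu m Q. Proof. by case: QQ_good => + _ _ _; apply. Qed.

Let QQ_monic Q : QQ Q -> Q \is monic.
Proof. by move/QQ_Psi=> -[[]]. Qed.

Let QQ_size Q : QQ Q -> size Q = m.+1.
Proof.
move=> QQ_Q; have [_ <-] := QQ_Psi QQ_Q.
by rewrite prednK // size_poly_gt0 monic_neq0 // QQ_monic.
Qed.

Let QQ_gt1 Q : QQ Q -> (1 < size Q)%N.
Proof. by move/QQ_size->. Qed.

(** The instance of the abstract set [E]. By [QQ_key_lt], levels increase along [QQ], so final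
    segments of one correspond to those of the other. *)
Definition levels (e : L) : Prop := exists Q d q, QQ Q /\ gauss_key nu e d Q q.

Lemma QQ_key Q : QQ Q -> exists e d q, gauss_key nu e d Q q.
Proof.
move=> QQ_Q; have psiQ := QQ_Psi QQ_Q; have [keyQ _] := psiQ.
(* An infinite [nu Q] would be a maximal value, so [nu Q] is finite. *)
have [P' _] := Psi_nomax psiQ; case nuQ: (nu Q) => [q|] //; last by case: (nu P').
move=> _.
have [e [d kQ]] := key_poly_gauss vP nuP keyQ (QQ_gt1 QQ_Q) nuQ.
by exists e, d, q.
Qed.

Lemma QQ_key_lt Q R e d q e' d' r : QQ Q -> QQ R ->
  gauss_key nu e d Q q -> gauss_key nu e' d' R r ->
  ltE (nu Q) (nu R) -> ltE (Some e) (Some e').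
Proof.
move=> QQ_Q QQ_R kQ kR QR; apply: (gauss_key_lt nuP _ _ _ kQ kR).
- exact: QQ_monic.
- exact: QQ_monic.
- by rewrite !QQ_size.
- by case: kQ kR QR => _ -> _ _ [_ -> _ _].
Qed.

Lemma levels_nomax e : levels e -> exists2 e', levels e' & ltE (Some e) (Some e').
Proof.
move=> [Q [d [q [QQ_Q kQ]]]]; have [P' psiP' QP'] := Psi_nomax (QQ_Psi QQ_Q).
have [_ _ _ /(_ P' psiP')[R QQ_R P'R]] := QQ_good.
have [e' [d' [r kR]]] := QQ_key QQ_R.
exists e'; first by exists R, d', r.
exact: (QQ_key_lt QQ_Q QQ_R kQ kR (ltE_le_trans QP' P'R)).
Qed.

Lemma levels_dom e : levels e -> forall p : {poly K}, p != 0 ->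
  exists c d, gauss_dom nu e (taylor p) c d.
Proof.
move=> [Q [d [q [QQ_Q kQ]]]] p p0.
have [k _ [dom _]] := nuQ_gauss nuP (QQ_gt1 QQ_Q) kQ p0.
by exists k, (d * degQ nu Q p)%N.
Qed.

Lemma gauss_dom_le_nu e (p : {poly K}) c d :
  gauss_dom nu e (taylor p) c d -> leE (Some c) (nu p).
Proof.
by move=> [_ /(_ 0%N) + _]; rewrite /gterm coef_taylor /hasse nderivn0 mulr0n addE0.
Qed.

(** If one truncation reaches [nu f], every later one is squeezed between it and [nu f], and [f] is
    stable. A later [R] with [nu R = nu Q] is [Q] itself by injectivity of [nu] on [QQ]. *)
Lemma not_stable_unstable (f : {poly K}) : f != 0 -> ~ Qstable nu QQ f ->
  unstable nu levels f.
Proof.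
move=> f0 nst e c D [Q [d [q [QQ_Q kQ]]]] domf.
rewrite ltEN; apply/negP => fc; apply: nst; exists Q => // R QQ_R QR.
have nufc : nu f = Some c by apply: leE_anti => //; apply: gauss_dom_le_nu domf.
have [k nuQf [domQ _]] := nuQ_gauss nuP (QQ_gt1 QQ_Q) kQ f0.
have [kc _] := gauss_dom_uniq domQ domf.
have [QRE|QRne] := eqVneq (nu Q) (nu R).
  have [_ inj _ _] := QQ_good.
  by rewrite -(inj _ _ QQ_Q QQ_R QRE) nuQf nufc kc.
have [e' [d' [r kR]]] := QQ_key QQ_R.
have ee' : ltE (Some e) (Some e').
  by apply: (QQ_key_lt QQ_Q QQ_R kQ kR); rewrite /ltE QRne.
have [k' nuRf [domR _]] := nuQ_gauss nuP (QQ_gt1 QQ_R) kR f0.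
rewrite nuRf; apply: leE_anti; first exact: gauss_dom_le_nu domR.
by rewrite nufc; apply: (gauss_dom_le (ltEW ee') domf domR).
Qed.

Lemma stable_stable_at (g : {poly K}) : g != 0 -> Qstable nu QQ g ->
  exists l e0, [/\ nu g = Some l, levels e0 & stable_at nu levels g l e0].
Proof.
move=> g0 [Q QQ_Q st]; have [e0 [d [q kQ]]] := QQ_key QQ_Q.
have [l nuQg _] := nuQ_gauss nuP (QQ_gt1 QQ_Q) kQ g0.
have nug : nu g = Some l by rewrite -(st Q) ?leExx.
exists l, e0; split=> //; first by exists Q, d, q.
move=> e [R [d' [r [QQ_R kR]]]] e0e.
have QR : leE (nu Q) (nu R).
  rewrite -[leE _ _]negbK -ltEN; apply/negP => RQ.
  by have := QQ_key_lt QQ_R QQ_Q kR kQ RQ; rewrite ltEN /= e0e.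
have [k nuRg [domR _]] := nuQ_gauss nuP (QQ_gt1 QQ_R) kR g0.
exists (d' * degQ nu R g)%N.
by have := st R QQ_R QR; rewrite nuRg nug => -[<-].
Qed.

(** Limit key polynomials have minimal degree among monic polynomials only; scaling extends this to
    all nonzero ones. *)
Lemma QstableZ (a : K) (g : {poly K}) : a != 0 -> g != 0 ->
  Qstable nu QQ g -> Qstable nu QQ (a *: g).
Proof.
move=> a0 g0 [Q0 QQ_Q0 st]; exists Q0 => // Q QQ_Q Q0Q.
have [e [d [q kQ]]] := QQ_key QQ_Q; have [_ _ nuM _] := nur.
have ag0 : a *: g != 0 by rewrite scaler_eq0 negb_or a0.
have [k nuQg [dom _]] := nuQ_gauss nuP (QQ_gt1 QQ_Q) kQ g0.
have [k' nuQag [dom' _]] := nuQ_gauss nuP (QQ_gt1 QQ_Q) kQ ag0.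
have [c va] := valuation_neq0 vP a0.
have nua : nu a%:P = Some c by rewrite (nuC nuP).
move: dom'; rewrite -mul_polyC taylorM taylorC => dom'.
have [kE _] := gauss_dom_uniq dom' (gauss_domM nur (gauss_domC nur e nua) dom).
by rewrite mul_polyC nuQag kE -mul_polyC nuM nua -(st Q QQ_Q Q0Q) nuQg.
Qed.

Variable f : {poly K}.
Hypothesis f_limit : limit_key_poly nu QQ f.

Lemma limit_monic : f \is monic. Proof. by case: f_limit. Qed.

Let f0 : f != 0. Proof. exact: monic_neq0 limit_monic. Qed.

Lemma limit_unstable : unstable nu levels f.
Proof. by apply: not_stable_unstable => //; case: f_limit. Qed.

Lemma limit_minimal (g : {poly K}) : g != 0 -> (size g < size f)%N ->
  exists l e0, [/\ nu g = Some l, levels e0 & stable_at nu levels g l e0].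
Proof.
move=> g0 gf; apply: stable_stable_at => //.
have lg0 : lead_coef g != 0 by rewrite lead_coef_eq0.
have gE : g = lead_coef g *: ((lead_coef g)^-1 *: g) by rewrite scalerA mulfV ?scale1r.
rewrite gE; apply: QstableZ => //; first by rewrite scaler_eq0 negb_or invr_eq0 lg0.
apply: boolp.contrapT; case: f_limit => _ _ /(_ ((lead_coef g)^-1 *: g)).
rewrite size_scale ?invr_eq0 // leqNgt gf => min_f nst; suff: false by [].
by apply: min_f => //; rewrite monicE lead_coefZ mulVf.
Qed.

(** Dominant exponent 0 would make the truncated value equal to [nu f], against instability. *)
Lemma degQ_gt0 Q : QQ Q -> (0 < degQ nu Q f)%N.
Proof.
move=> QQ_Q; have [e [d [q kQ]]] := QQ_key QQ_Q.
have [k _ [dom _]] := nuQ_gauss nuP (QQ_gt1 QQ_Q) kQ f0.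
rewrite lt0n; apply/eqP => D0; rewrite D0 muln0 in dom.
have := limit_unstable (ex_intro _ Q (ex_intro _ d (ex_intro _ q (conj QQ_Q kQ)))) dom.
case: dom; rewrite /gterm coef_taylor /hasse nderivn0 mulr0n addE0 => -> _ _.
by rewrite ltE_irr.
Qed.

(** Two factors of smaller degree are stable; at a level beyond both thresholds the truncated value
    of [f] would be the sum of their values, which is [nu f]. *)
Lemma limit_irreducible : (1 < size f)%N -> irreducible_poly f.
Proof.
move=> f1; split=> // g g1 gf.
have g0 : g != 0 by apply: contraTneq gf => ->; rewrite dvd0p.
have [h fE] := dvdpP _ _ gf.
have h0 : h != 0 by apply: contraNneq f0 => h0; rewrite fE h0 mul0r.
rewrite -dvdp_size_eqp //; apply: contraT => szne.
have ltgf : (size g < size f)%N by rewrite ltn_neqAle szne dvdp_leq.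
have lthf : (size h < size f)%N.
  move: g1 (size_poly_eq0 g); rewrite fE size_mul // (negPf g0).
  case: (size g) => [|[|k]] //= _ _; rewrite addnS /= addnS ltnS; exact: leq_addr.
have [l [e1 [gl Ee1 st_g]]] := limit_minimal g0 ltgf.
have [l' [e2 [hl Ee2 st_h]]] := limit_minimal h0 lthf.
have [e [Ee e1e e2e]] : exists e, [/\ levels e, leL e1 e & leL e2 e].
  by case/orP: (leL_total e1 e2) => e12; [exists e2|exists e1]; rewrite ?leLL.
have [d dom_g] := st_g e Ee e1e; have [d' dom_h] := st_h e Ee e2e.
have := gauss_domM nur dom_h dom_g; rewrite -taylorM -fE => /(limit_unstable Ee).
by rewrite fE; have [_ _ -> _] := nur; rewrite gl hl ltE_irr.
Qed.

End LimitKeyPolynomials.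

Theorem mainTheorem5 (K : fieldType) (L : divOrdGroup) (v : K -> option L)
    (nu : {poly K} -> option L) (m : nat) (QQ : {poly K} -> Prop) :
  is_valuation v ->
  is_poly_valuation v nu ->
  well_specified v nu ->
  (0 < m)%N ->
  (exists Q, Psi nu m Q) ->
  (forall P, Psi nu m P -> exists2 P', Psi nu m P' & ltE (nu P) (nu P')) ->
  good_family nu m QQ ->
  (exists g, ~ Qstable nu QQ g) ->
  henselian v ->
  forall f Q, limit_key_poly nu QQ f -> QQ Q ->
    (size f).-1 = (degQ nu Q f * (size Q).-1)%N.
Proof.
move=> vP nuP _ m0 _ nomax good _ hens f Q f_limit QQ_Q.
have f_monic := limit_monic f_limit; have f0 := monic_neq0 f_monic.
have [QQ_Psi _ _ _] := good; have [[Q_monic _] szQ] := QQ_Psi Q QQ_Q.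
have szQ' : size Q = m.+1 by rewrite -szQ prednK // size_poly_gt0 monic_neq0.
have Q1 : (1 < size Q)%N by rewrite szQ'.
have D0 := degQ_gt0 vP nuP m0 nomax good f_limit QQ_Q.
have [e [d [q kQ]]] := QQ_key vP nuP m0 nomax good QQ_Q.
have [k _ [domf le_f]] := nuQ_gauss nuP Q1 kQ f0.
have [d0 _ domQ _] := kQ.
have f1 : (1 < size f)%N.
  move: le_f; rewrite szQ; case: (size f) => [|[|n]] //=;
  by rewrite leqn0 muln_eq0 !eqn0Ngt D0 m0.
apply/eqP; rewrite eqn_leq le_f andbT.
(* The counting needs [deg Q < deg f], so that derivatives of [Q] have known values at the roots of
   [f]. Otherwise the bound follows from [deg_Q f >= 1]. *)
have [fQ|Qf] := leqP (size f) (size Q).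
  apply: leq_trans (leq_pmull _ D0); rewrite szQ' /=.
  by move: fQ; rewrite szQ'; case: (size f).
(* The number [d] of roots of [Q] in a ball occurs on both sides of the counting inequality and
   cancels, being positive. *)
rewrite mulnC -(leq_pmul2r d0) -mulnA [(degQ _ _ _ * d)%N]mulnC.
apply: (degree_bound vP nuP hens (limit_irreducible vP nuP m0 nomax good f_limit f1)
  f_monic Q_monic Qf (levels_nomax vP nuP m0 nomax good)
  (levels_dom nuP m0 good) (limit_unstable vP nuP m0 nomax good f_limit)
  (limit_minimal vP nuP m0 nomax good f_limit) (e := e) _ domQ domf).
by exists Q, d, q.
Qed.
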